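(* Let $f(z)=z+\sum_{n\ge 2}a_nz^n\in\mathcal{BT}_{\mathfrak{B}}$ and let $\gamma_1,\gamma_2$ be its logarithmic coefficients. Then $$-\frac{1}{2\sqrt{23}}\le|\gamma_2|-|\gamma_1|\le\frac1{12}.$$ Both inequalities are sharp: the upper bound is attained by $f_2(z)=\int_0^z\sqrt{1+\tanh(t^2)}\,dt$, and the lower bound by the function $f$ with $f(0)=0$, $f'(z)=\sqrt{1+\tanh(\omega(z))}$, where $\omega=\frac{p-1}{p+1}$ and $p(z)=\dfrac{1+\frac{8}{\sqrt{23}}z+z^2}{1-z^2}$.
   Context: $\mathbb{D}=\{z\in\mathbb{C}:|z|<1\}$. $\mathcal{S}$ is the class of univalent analytic functions $f$ on $\mathbb{D}$ normalized by $f(0)=0$, $f'(0)=1$, i.e. $f(z)=z+\sum_{n\ge2}a_nz^n$. For analytic $g,h$ on $\mathbb{D}$, $g\prec h$ means there is an analytic $\omega:\mathbb{D}\to\mathbb{D}$ with $\omega(0)=0$ and $g=h\circ\omega$. Let $\mathfrak{B}(z)=\sqrt{1+\tanh z}$ (principal branch, $\mathfrak{B}(0)=1$). The class $\mathcal{BT}_{\mathfrak{B}}$ is $\{f\in\mathcal{S}: f'(z)\prec \mathfrak{B}(z)\}$. The logarithmic coefficients are defined by $\log\frac{f(z)}{z}=2\sum_{n\ge1}\gamma_nz^n$; explicitly $\gamma_1=\tfrac12 a_2$, $\gamma_2=\tfrac12(a_3-\tfrac12a_2^2)$. *)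

(* Defs.v *)
(* mathcomp-analysis over an abstract R : realType,
   complex numbers are mathcomp-real-closed's R[i], viewed as a normed
   module over itself via the ^o alias, so that complex differentiability
   is mathcomp-analysis' [derivable]/[derive1] with the field R[i]. *)
From HB Require Import structures.
From mathcomp Require Import all_boot all_order all_algebra.
From mathcomp Require Import all_classical all_reals all_analysis.
From mathcomp Require Import complex.
Set Implicit Arguments. Unset Strict Implicit. Unset Printing Implicit Defensive.
Import Order.TTheory GRing.Theory Num.Theory.
Import numFieldNormedType.Exports.
Local Open Scope ring_scope.
Local Open Scope complex_scope.

Notation CC R := ((R[i])^o).

Definition inD (R : realType) (z : CC R) : Prop := `|z| < 1.

Definition holoD (R : realType) (f : CC R -> CC R) : Prop :=
  forall z : CC R, inD z -> derivable f z 1.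

Definition cexp (R : realType) (z : CC R) : CC R :=
  let: Complex x y := z in
  (expR x)%:C * ((cos y)%:C + 'i * (sin y)%:C).

Definition ctanh (R : realType) (z : CC R) : CC R :=
  (cexp (2 * z) - 1) / (cexp (2 * z) + 1).

(* principal branch of the square root (argument in (-pi/2, pi/2]):
   sqrt(a+ib) = sqrt((|w|+a)/2) + i sgn(b) sqrt((|w|-a)/2), sgn(0)=1 *)
Definition psqrt (R : realType) (w : CC R) : CC R :=
  let: Complex a b := w in
  let r := Num.sqrt (a ^+ 2 + b ^+ 2) in
  (Num.sqrt ((r + a) / 2))%:C
  + 'i * ((if b < 0 then -1 else 1) * Num.sqrt ((r - a) / 2))%:C.

Definition Bfun (R : realType) (z : CC R) : CC R := psqrt (1 + ctanh z).

Definition classS (R : realType) (f : CC R -> CC R) : Prop :=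
  [/\ holoD f,
      (forall z w : CC R, inD z -> inD w -> f z = f w -> z = w),
      f 0 = 0 & derive1 f 0 = 1].

Definition subordD (R : realType) (g h : CC R -> CC R) : Prop :=
  exists omega : CC R -> CC R,
    [/\ holoD omega, (forall z, inD z -> inD (omega z)), omega 0 = 0 &
        forall z, inD z -> g z = h (omega z)].

Definition classBT (R : realType) (f : CC R -> CC R) : Prop :=
  classS f /\ subordD (derive1 f) (@Bfun R).

Definition coef (R : realType) (f : CC R -> CC R) (n : nat) : CC R :=
  derive1n n f 0 / (n`!)%:R.

Definition gamma1 (R : realType) (f : CC R -> CC R) : CC R := coef f 2 / 2.
Definition gamma2 (R : realType) (f : CC R -> CC R) : CC R :=
  (coef f 3 - (coef f 2) ^+ 2 / 2) / 2.

Definition pext (R : realType) (z : CC R) : CC R :=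
  (1 + (8 / Num.sqrt (23 : R))%:C * z + z ^+ 2) / (1 - z ^+ 2).
Definition omega_ext (R : realType) (z : CC R) : CC R :=
  (pext z - 1) / (pext z + 1).

(* Main.v *)
(* With E = exp(2z), 1 + tanh z = 2E/(E + 1), so B = sqrt(1 + tanh) has positive real part on
   the disk and solves B' = B - B^3/2. If f' = B o w with w = c1 z + c2 z^2 + ..., this gives
   gamma1 = c1/8 and gamma2 = (c2 - 7/16 c1^2)/12, and the two bounds follow from
   |c2| <= 1 - |c1|^2 by calculus in |c1|. The upper bound is attained for w = z^2, the lower
   one for w = z(z + a)/(1 + az) with a = 4/sqrt 23, where c2 = 7/16 c1^2.

   The function theory is done without integrals, by averaging over the nodes r zeta^k,
   zeta = exp(2 i pi/n), and letting n tend to infinity. If h' is continuous, then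
   sum_k h'(x_k) (x_{k+1} - x_k) is small because the increments of h telescope around the
   circle; this gives the Cauchy formula and hence all the derivatives of h. No Goursat argument
   is needed: f' = B o w is differentiable, so f has a continuous derivative and f'' is again
   differentiable; w' = f''/(B' o w) is then continuous, and the same theory applies to w. *)
Require Import Defs.
From HB Require Import structures.
From mathcomp Require Import all_boot all_order all_algebra.
From mathcomp Require Import all_classical all_reals all_analysis.
From mathcomp Require Import complex.
From mathcomp Require Import ring lra.
Set Implicit Arguments. Unset Strict Implicit. Unset Printing Implicit Defensive.
Import Order.TTheory GRing.Theory Num.Theory.
Import numFieldNormedType.Exports.
Local Open Scope ring_scope.
Local Open Scope complex_scope.

(* [`|z|] lives in R[i]; [nm z] is the same modulus as an element of R. *)
Local Notation nm := (@Normc.normc _).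

(** Telescoping adds up n increments of size about 1/n, so the errors must be o(1/n) uniformly along
    the circle. Differentiability at each point does not give this; continuity of h' does, through
    the mean value theorem on segments and uniform continuity on closed disks. This is the reason
    for the detour through f: w is only assumed differentiable pointwise, so it cannot enter the
    averaging argument before w' is known to be continuous.

    The bound |c2| <= 1 - |c1|^2 is read off the same means. Testing against a kernel that is a
    perfect square, whose mean modulus is computable, replaces the Schwarz-Pick argument for w(z)/z
    and with it the maximum principle.

    Limits of means are differentiated by means of remainders that are quadratic in the increment
    and uniform in n.

    Sharpness needs actual members of the class: a primitive of B o w is built as a limit of Riemann
    sums along radii, and Re B > 0 makes it injective. *)

Section ComplexModulus.
Variable R : realType.
Local Notation C := R[i].
Implicit Types (z w : C) (x : R).

Lemma normr_nm z : `|z| = (nm z)%:C. Proof. by []. Qed.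

Lemma nm_ge0 z : 0 <= nm z.
Proof. by case: z => a b; rewrite /= sqrtr_ge0. Qed.

Lemma nm0 : nm (0 : C) = 0. Proof. exact: Normc.normc0. Qed.
Lemma nm1 : nm (1 : C) = 1. Proof. exact: Normc.normc1. Qed.
Lemma nmM z w : nm (z * w) = nm z * nm w. Proof. exact: Normc.normcM. Qed.
Lemma nmV z : nm z^-1 = (nm z)^-1. Proof. exact: Normc.normcV. Qed.
Lemma nmN z : nm (- z) = nm z. Proof. exact: normcN. Qed.
Lemma nmD z w : nm (z + w) <= nm z + nm w. Proof. exact: le_normcD. Qed.
Lemma nmX z n : nm (z ^+ n) = nm z ^+ n.
Proof. by elim: n => [|n IH]; rewrite ?expr0 ?nm1// !exprS nmM IH. Qed.
Lemma nmBC z w : nm (z - w) = nm (w - z).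
Proof. by rewrite -nmN opprB. Qed.
Lemma nmB z w : nm (z - w) <= nm z + nm w.
Proof. by rewrite -(nmN w); exact: nmD. Qed.
Lemma nmBB z w : nm z - nm w <= nm (z - w).
Proof. by rewrite lerBlDr -{1}(subrK w z) nmD. Qed.

Lemma nm_real x : nm x%:C = `|x|.
Proof. by rewrite /= expr0n addr0 sqrtr_sqr. Qed.

Lemma nm_nat n : nm (n%:R : C) = n%:R.
Proof.
rewrite (_ : n%:R = (n%:R : R)%:C); first by rewrite nm_real normr_nat.
by rewrite rmorph_nat.
Qed.

Lemma nm_eq0 z : (nm z == 0) = (z == 0).
Proof.
by apply/eqP/eqP => [/(@Normc.eq0_normc R)//|->]; rewrite nm0.
Qed.

Lemma nm_gt0 z : (0 < nm z) = (z != 0).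
Proof. by rewrite lt_neqAle nm_ge0 andbT eq_sym nm_eq0. Qed.

Lemma nm_sq z : nm z ^+ 2 = complex.Re z ^+ 2 + complex.Im z ^+ 2.
Proof. by case: z => a b; rewrite /= sqr_sqrtr// addr_ge0// sqr_ge0. Qed.

Lemma Re_le_nm z : `|complex.Re z| <= nm z.
Proof.
rewrite -(@ler_pXn2r _ 2)// ?nnegrE ?nm_ge0// nm_sq real_normK ?num_real//.
by rewrite lerDl sqr_ge0.
Qed.

Lemma Im_le_nm z : `|complex.Im z| <= nm z.
Proof.
rewrite -(@ler_pXn2r _ 2)// ?nnegrE ?nm_ge0// nm_sq real_normK ?num_real//.
by rewrite lerDr sqr_ge0.
Qed.

Lemma nm_le_ReIm z : nm z <= `|complex.Re z| + `|complex.Im z|.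
Proof.
have h := (normr_ge0 (complex.Re z), normr_ge0 (complex.Im z)).
rewrite -(@ler_pXn2r _ 2)// ?nnegrE ?nm_ge0 ?addr_ge0// nm_sq.
rewrite -(real_normK (num_real (complex.Re z))).
rewrite -(real_normK (num_real (complex.Im z))) sqrrD.
by rewrite lerD2r lerDl mulrn_wge0// mulr_ge0.
Qed.

Lemma ReD z w : complex.Re (z + w) = complex.Re z + complex.Re w.
Proof. by case: z; case: w. Qed.
Lemma ReN z : complex.Re (- z) = - complex.Re z.
Proof. by case: z. Qed.
Lemma ReM z w : complex.Re (z * w) =
  complex.Re z * complex.Re w - complex.Im z * complex.Im w.
Proof. by case: z; case: w. Qed.
Lemma ReZ x z : complex.Re (x%:C * z) = x * complex.Re z.
Proof. by rewrite ReM /= mul0r subr0. Qed.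

Lemma nm_sum (I : Type) (r : seq I) (F : I -> C) :
  nm (\sum_(i <- r) F i) <= \sum_(i <- r) nm (F i).
Proof.
elim: r => [|i r IH]; first by rewrite !big_nil nm0.
by rewrite !big_cons (le_trans (nmD _ _))// lerD2l.
Qed.

(** The rotation e turns a modulus into the real part of a linear expression, which is how real mean
    value arguments yield complex norm estimates without loss. *)
Lemma exists_phase z : exists2 e : C, nm e = 1 & e * z = (nm z)%:C.
Proof.
have [->|z0] := eqVneq z 0; first by exists 1; rewrite ?nm1 // mulr0 nm0.
exists ((nm z)%:C / z); last by rewrite divfK.
by rewrite nmM nmV nm_real ger0_norm ?nm_ge0// divff // nm_eq0.
Qed.

End ComplexModulus.

(** * Complex derivatives in epsilon-delta form *)

Section ComplexDerivative.
Local Open Scope classical_set_scope.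
Variable R : realType.
Local Notation C := R[i].
Implicit Types (f g : C -> C) (z w l : C).

(** All radii and errors live in [R], and there is no division: u = 0 is allowed, so the chain rule
    needs no case split when the inner increment vanishes. *)
Definition cder f z l := forall e : R, 0 < e -> exists2 d : R, 0 < d &
  forall u : C, nm u < d -> nm (f (z + u) - f z - l * u) <= e * nm u.

Definition ccont f z := forall e : R, 0 < e -> exists2 d : R, 0 < d &
  forall u : C, nm u < d -> nm (f (z + u) - f z) <= e.

(** A positive element of [R[i]] is real, so its real part serves as the radius. *)
Lemma dnbhs0P (P : C -> Prop) :
  (\forall h \near (0 : CC R)^', P h) <->
  exists2 d : R, 0 < d & forall h : C, h != 0 -> nm h < d -> P h.
Proof.
split.
  move=> /nbhs_ballP[d /= d0 H].
  exists (complex.Re d); first by move: d0; rewrite ltcE => /andP[].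
  move=> h h0 hd; apply: H => //=.
  rewrite /ball /= sub0r normrN normr_nm ltcE /= hd andbT.
  by move: d0; rewrite ltcE /= => /andP[].
move=> [d d0 H]; apply/nbhs_ballP; exists d%:C => /=; first by rewrite ltcR.
move=> h; rewrite /ball /= sub0r normrN normr_nm ltcR => hd h0.
exact: H.
Qed.

Lemma cder_is_derive f z l : cder f z l <-> is_derive (z : CC R) 1 (f : CC R -> CC R) l.
Proof.
have alg (h a b c : C) : h != 0 -> c - h^-1 * (a - b) = - (h^-1 * (a - b - c * h)).
  by move=> h0; field.
have key : cder f z l <->
    ((fun h : CC R => h^-1 *: (((f : CC R -> CC R) \o shift (z : CC R)) (h *: (1 : CC R))
        - (f z : CC R)) : CC R) @ (0 : CC R)^' --> (l : CC R)).
  split.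
    move=> H; apply/cvgrPdist_le => e e0.
    have [e' e'E] : exists e' : R, e = e'%:C.
      by exists (complex.Re e); move: e0; case: e => a b; rewrite ltcE /= => /andP[/eqP->].
    move: e0; rewrite e'E ltcR => e0.
    have [d d0 Hd] := H _ e0.
    apply/dnbhs0P; exists d => // h h0 hd.
    have Hh := Hd h hd.
    have -> : l - h^-1 *: (f (h *: (1 : CC R) + z) - f z) =
       - (h^-1 * (f (z + h) - f z - l * h)) :> C.
      rewrite /GRing.scale /= mulr1 (addrC h z); exact: alg.
    rewrite normr_nm lecR nmN nmM nmV -ler_pdivlMl ?invr_gt0 ?nm_gt0//.
    by rewrite invrK [leRHS]mulrC.
  move=> H e e0.
  have e0' : (0 : C) < e%:C by rewrite ltcR.
  have [d d0 Hd] := (dnbhs0P _).1 ((cvgrPdist_le _ _).1 H _ e0'); exists d => // u ud.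
  have [->|u0] := eqVneq u 0; first by rewrite addr0 subrr mulr0 subr0 nm0 mulr0.
  have /= := Hd u u0 ud.
  have -> : l - u^-1 *: (f (u *: (1 : CC R) + z) - f z) =
       - (u^-1 * (f (z + u) - f z - l * u)) :> C.
    rewrite /GRing.scale /= mulr1 (addrC u z); exact: alg.
  rewrite normr_nm lecR nmN nmM nmV -ler_pdivlMl ?invr_gt0 ?nm_gt0//.
  by rewrite invrK [leRHS]mulrC.
split.
  move=> /key H; split; first by apply/cvg_ex; exists l.
  by apply: cvg_lim.
by move=> [H dl]; apply/key; rewrite -dl.
Qed.

Lemma cder_derivable f z l : cder f z l -> derivable (f : CC R -> CC R) z 1.
Proof. by move=> /cder_is_derive[]. Qed.

Lemma cder_derive1 f z l : cder f z l -> derive1 (f : CC R -> CC R) z = l.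
Proof. by move=> /cder_is_derive[_ <-]; rewrite derive1E. Qed.

Lemma derivable_cder f z : derivable (f : CC R -> CC R) z 1 ->
  cder f z (derive1 (f : CC R -> CC R) z).
Proof. by move=> /derivableP; rewrite -derive1E => /cder_is_derive. Qed.

Lemma cder_uniq f z l l' : cder f z l -> cder f z l' -> l = l'.
Proof. by move=> /cder_derive1 <- /cder_derive1 <-. Qed.

Lemma cder_eq f g z l : (exists2 d : R, 0 < d & forall u, nm u < d -> f (z + u) = g (z + u)) ->
  cder f z l -> cder g z l.
Proof.
move=> [d d0 fg] H e e0; have [d' d'0 Hd] := H e e0.
exists (Num.min d d'); first by rewrite lt_min d0.
move=> u; rewrite lt_min => /andP[ud ud'].
rewrite -fg // -{2}(addr0 z) -fg ?nm0// addr0; exact: Hd.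
Qed.

Lemma cder_ext f g z l : f =1 g -> cder f z l -> cder g z l.
Proof. by move=> fg; apply: cder_eq; exists 1. Qed.

Lemma cder_cst (c z : C) : cder (fun=> c) z 0.
Proof. by apply/cder_is_derive; exact: is_derive_cst. Qed.

Lemma cder_id z : cder id z 1.
Proof. by apply/cder_is_derive; exact: is_derive_id. Qed.

Lemma cderD f g z l l' : cder f z l -> cder g z l' ->
  cder (fun z => f z + g z) z (l + l').
Proof. by move=> /cder_is_derive H /cder_is_derive H'; apply/cder_is_derive; exact: is_deriveD. Qed.

Lemma cderN f z l : cder f z l -> cder (fun z => - f z) z (- l).
Proof. by move=> /cder_is_derive H; apply/cder_is_derive; exact: is_deriveN. Qed.

Lemma cderB f g z l l' : cder f z l -> cder g z l' ->
  cder (fun z => f z - g z) z (l - l').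
Proof. by move=> H H'; apply: cderD => //; exact: cderN. Qed.

Lemma cderM f g z l l' : cder f z l -> cder g z l' ->
  cder (fun z => f z * g z) z (l * g z + f z * l').
Proof.
move=> /cder_is_derive H /cder_is_derive H'; apply/cder_is_derive.
have := @is_deriveM _ _ (f : CC R -> C) (g : CC R -> C) (z : CC R) 1 _ _ H H'.
by rewrite /GRing.scale /= addrC [g z * _]mulrC.
Qed.

Lemma cderZ (c : C) f z l : cder f z l -> cder (fun z => c * f z) z (c * l).
Proof.
by move=> H; have := cderM (cder_cst c z) H; rewrite mul0r add0r.
Qed.

Lemma ccont_cder f z l : cder f z l -> ccont f z.
Proof.
move=> H e e0; have [d d0 Hd] := H 1 ltr01.
have k0 : 0 < 1 + nm l by rewrite ltr_pwDl ?nm_ge0.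
exists (Num.min d (e / (1 + nm l))); first by rewrite lt_min d0 divr_gt0.
move=> u; rewrite lt_min => /andP[ud]; rewrite ltr_pdivlMr // => ue.
have -> : f (z + u) - f z = (f (z + u) - f z - l * u) + l * u by ring.
apply: le_trans (nmD _ _) _; rewrite nmM.
have := Hd u ud; lra.
Qed.

Lemma cder_comp f g z l l' : cder f z l -> cder g (f z) l' ->
  cder (fun z => g (f z)) z (l' * l).
Proof.
move=> Hf Hg e e0.
have k0 : 0 < 1 + nm l by rewrite ltr_pwDl ?nm_ge0.
have k0' : 0 < 1 + nm l' by rewrite ltr_pwDl ?nm_ge0.
(* The error splits into e2 |v| and |l'| e1 |u|, each at most e/2 |u|. The cap e1 <= 1 gives |v| <=
   (1 + |l|) |u|. *)
set e1 := Num.min 1 (e / 2 / (1 + nm l')).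
have e10 : 0 < e1 by rewrite lt_min ltr01 !divr_gt0.
set e2 := e / 2 / (1 + nm l).
have e20 : 0 < e2 by rewrite !divr_gt0.
have [d1 d10 H1] := Hf _ e10.
have [d2 d20 H2] := Hg _ e20.
exists (Num.min d1 (d2 / (1 + nm l))); first by rewrite lt_min d10 divr_gt0.
move=> u; rewrite lt_min => /andP[ud1]; rewrite ltr_pdivlMr // => ud2.
set v := f (z + u) - f z.
have Hv := H1 u ud1; rewrite -/v in Hv.
have nmv : nm v <= nm u * (1 + nm l).
  have -> : v = (v - l * u) + l * u by ring.
  apply: le_trans (nmD _ _) _; rewrite nmM.
  have : e1 * nm u <= nm u.
    by rewrite -[leRHS]mul1r ler_wpM2r ?nm_ge0// ge_min lexx.
  lra.
have := H2 v (le_lt_trans nmv ud2).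
rewrite /v (addrC (f z)) subrK -/v => H3.
have -> : g (f (z + u)) - g (f z) - l' * l * u =
  (g (f (z + u)) - g (f z) - l' * v) + l' * (v - l * u) by ring.
apply: le_trans (nmD _ _) _; rewrite nmM.
have h1 : e2 * nm v <= e / 2 * nm u.
  apply: (@le_trans _ _ (e2 * (nm u * (1 + nm l)))); first by rewrite ler_wpM2l// ltW.
  by rewrite mulrCA /e2 divfK ?gt_eqF// mulrC.
have h2 : nm l' * nm (v - l * u) <= e / 2 * nm u.
  apply: (@le_trans _ _ ((1 + nm l') * (e / 2 / (1 + nm l') * nm u))).
    apply: ler_pM; rewrite ?nm_ge0// ?lerDr//.
    by apply: (le_trans Hv); rewrite ler_wpM2r ?nm_ge0// ge_min lexx orbT.
  by rewrite mulrA [X in X * nm u]mulrC divfK ?gt_eqF.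
lra.
Qed.

Lemma cderV f z l : f z != 0 -> cder f z l ->
  cder (fun z => (f z)^-1) z (- (l / f z ^+ 2)).
Proof.
move=> f0 /cder_is_derive[H dl]; apply/cder_is_derive; split.
  exact: (@derivableV _ _ (f : CC R -> C) z 1 f0 H).
rewrite (@deriveV _ _ (f : CC R -> C) z 1 f0 H) dl.
by rewrite /GRing.scale /= mulNr mulrC.
Qed.

Lemma cder_div f g z l l' : g z != 0 -> cder f z l -> cder g z l' ->
  cder (fun z => f z / g z) z ((l * g z - f z * l') / g z ^+ 2).
Proof.
move=> g0 Hf Hg; have := cderM Hf (cderV g0 Hg).
by congr cder; field.
Qed.

Lemma cderX n f z l : cder f z l -> cder (fun z => f z ^+ n) z (n%:R * f z ^+ n.-1 * l).
Proof.
move=> H; elim: n => [|n IH].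
  by rewrite !mul0r; exact: cder_cst.
have := cderM H IH.
under [X in cder X]funext do rewrite -exprS.
congr cder; case: n {IH} => [|n] /=; first by rewrite expr0; ring.
by rewrite exprS; ring.
Qed.

Lemma cder_sum (I : Type) (r : seq I) (F : I -> C -> C) (L : I -> C) z :
  (forall i, cder (F i) z (L i)) ->
  cder (fun z => \sum_(i <- r) F i z) z (\sum_(i <- r) L i).
Proof.
move=> H; elim: r => [|i r IH].
  rewrite big_nil; apply: (@cder_ext (fun=> 0)); last exact: cder_cst.
  by move=> w; rewrite big_nil.
rewrite big_cons; apply: (@cder_ext _ _ _ _ _ (cderD (H i) IH)).
by move=> w; rewrite big_cons.
Qed.

End ComplexDerivative.

(** * Real derivatives in the same form *)

Section RealDerivative.
Variable R : realType.
Implicit Types (f : R -> R) (t l : R).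
Local Open Scope classical_set_scope.

Lemma real_is_deriveP f t l : is_derive t 1 f l <->
  forall e : R, 0 < e -> exists2 d : R, 0 < d &
  forall s, `|s| < d -> `|f (t + s) - f t - l * s| <= e * `|s|.
Proof.
have alg (h a b c : R) : h != 0 -> c - h^-1 * (a - b) = - (h^-1 * (a - b - c * h)).
  by move=> h0; field.
have key : (h^-1 *: ((f \o shift t) (h *: (1 : R)) - f t) @[h --> (0 : R)^'] --> l) <->
  forall e : R, 0 < e -> exists2 d : R, 0 < d &
  forall s, `|s| < d -> `|f (t + s) - f t - l * s| <= e * `|s|.
  split.
    move=> H e e0; have [d d0 Hd] := (nbhs_ballP _ _).1 ((cvgrPdist_le _ _).1 H _ e0).
    exists d => // s sd.
    have [->|s0] := eqVneq s 0; first by rewrite addr0 subrr mulr0 subr0 normr0 mulr0.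
    have /= := Hd s; rewrite /ball /= sub0r normrN => /(_ sd s0).
    rewrite /GRing.scale /= mulr1 (addrC s) alg // normrN normrM normfV.
    by rewrite ler_pdivrMl ?normr_gt0// [_ * e]mulrC.
  move=> H; apply/cvgrPdist_le => e e0; have [d d0 Hd] := H _ e0.
  apply/nbhs_ballP; exists d => // s; rewrite /ball /= sub0r normrN => sd s0.
  rewrite /GRing.scale /= mulr1 (addrC s) alg // normrN normrM normfV.
  by rewrite ler_pdivrMl ?normr_gt0// [_ * e]mulrC; exact: Hd.
split.
  by move=> [H dl]; apply/key; rewrite -dl.
move=> /key H; split; first by apply/cvg_ex; exists l.
exact: cvg_lim.
Qed.

End RealDerivative.

(** * Mean value estimates and uniformity on closed disks *)

Section MeanValue.
Variable R : realType.
Local Notation C := R[i].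
Implicit Types (h : C -> C) (x y e : C).

Definition on_seg (P : C -> Prop) x y :=
  forall t : R, 0 <= t <= 1 -> P (x + t%:C * (y - x)).

Lemma on_seg_disk (r : R) x y : nm x <= r -> nm y <= r ->
  on_seg (fun z => nm z <= r) x y.
Proof.
move=> xr yr t /andP[t0 t1].
rewrite (_ : _ + _ = (1 - t)%:C * x + t%:C * y); last by rewrite rmorphB /=; ring.
apply: le_trans (nmD _ _) _; rewrite !nmM !nm_real !ger0_norm ?subr_ge0//.
have -> : r = (1 - t) * r + t * r by ring.
by rewrite lerD// ler_wpM2l// subr_ge0.
Qed.

(** The mean value theorem fails for complex values but holds for each real functional Re(e h): it
    is the real theorem applied to t -> Re(e h(x + t(y - x))). The point t depends on e. *)
Lemma seg_MVT h (h' : C -> C) x y e : on_seg (fun z => cder h z (h' z)) x y ->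
  exists2 t : R, 0 <= t <= 1 &
  complex.Re (e * (h y - h x)) = complex.Re (e * (h' (x + t%:C * (y - x)) * (y - x))).
Proof.
move=> H.
pose p (t : R) : R := complex.Re (e * h (x + t%:C * (y - x))).
pose dp (t : R) : R := complex.Re (e * (h' (x + t%:C * (y - x)) * (y - x))).
have D (t : R) : 0 <= t <= 1 -> is_derive t 1 p (dp t).
  move=> t01; apply/real_is_deriveP => eps eps0.
  set k := 1 + nm e * nm (y - x).
  have k0 : 0 < k by rewrite ltr_pwDl// mulr_ge0// nm_ge0.
  have k1 : 0 < 1 + nm (y - x) by rewrite ltr_pwDl// nm_ge0.
  have [d d0 Hd] := H t t01 _ (divr_gt0 eps0 k0).
  exists (d / (1 + nm (y - x))); first exact: divr_gt0.
  move=> s; rewrite ltr_pdivlMr// => sd.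
  have nms : nm (s%:C * (y - x)) = `|s| * nm (y - x) by rewrite nmM nm_real.
  have su : nm (s%:C * (y - x)) < d.
    by rewrite nms (le_lt_trans _ sd)// ler_wpM2l// lerDr.
  have := Hd _ su; set u := s%:C * (y - x); rewrite -/u in nms.
  set D := _ - _ - _ => HD.
  have -> : p (t + s) - p t - dp t * s = complex.Re (e * D).
    rewrite /p /dp /D [_ * s]mulrC -ReZ -!ReN -!ReD; congr complex.Re.
    rewrite rmorphD /= mulrDl addrA -/u /u; ring.
  apply: le_trans (Re_le_nm _) _; rewrite nmM.
  apply: (@le_trans _ _ (nm e * (eps / k * nm u))); first by rewrite ler_wpM2l// nm_ge0.
  rewrite nms.
  have -> : nm e * (eps / k * (`|s| * nm (y - x))) = eps * `|s| * ((nm e * nm (y - x)) / k) by ring.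
  rewrite -[leRHS]mulr1; apply: ler_wpM2l; first by rewrite mulr_ge0// ltW.
  by rewrite ler_pdivrMr// mul1r lerDr.
have [||c c01 E] := @MVT_segment R p dp 0 1 ler01.
- by move=> t; rewrite in_itv /= => /andP[t0 t1]; apply: D; rewrite !ltW.
- apply: derivable_within_continuous => t; rewrite in_itv /= => t01.
  by case: (D t t01).
exists c; first by move: c01; rewrite in_itv.
move: E; rewrite subr0 mulr1 /p /dp => <-.
by rewrite mul0r addr0 mul1r (addrC x (y - x)) subrK -ReN -ReD mulrBr.
Qed.

(** Take e to be the phase of the left-hand side and apply the real mean value theorem to h - c id.
    The choice c = 0 gives a Lipschitz bound, c = h' x a first-order expansion. *)
Lemma seg_diff_le h (h' : C -> C) (c : C) (M : R) x y :
  on_seg (fun z => cder h z (h' z)) x y ->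
  on_seg (fun z => nm (h' z - c) <= M) x y ->
  nm (h y - h x - c * (y - x)) <= M * nm (y - x).
Proof.
move=> H HM.
have [e e1 eE] := exists_phase (h y - h x - c * (y - x)).
have H' : on_seg (fun z => cder (fun z => h z - c * z) z (h' z - c * 1)) x y.
  by move=> t t01; apply: cderB; [exact: H|exact: cderZ (cder_id _)].
have [t t01] := seg_MVT e H'.
have -> : h y - c * y - (h x - c * x) = h y - h x - c * (y - x) by ring.
rewrite eE /= mulr1 => ->.
apply: le_trans (ler_norm _) _; apply: le_trans (Re_le_nm _) _.
rewrite !nmM e1 mul1r ler_wpM2r ?nm_ge0//.
exact: HM.
Qed.

Local Open Scope classical_set_scope.

(** Heine-Cantor. Compactness is taken from the square [-1, 1]^2 in [R * R], which contains the
    disk; the near-covering form of compactness makes one d work for all base points. *)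
Lemma disk_unif_cont h (r e : R) : (forall z, nm z < 1 -> ccont h z) ->
  r < 1 -> 0 < e -> exists2 d : R, 0 < d &
  forall x y, nm x <= r -> nm y <= r -> nm (y - x) < d -> nm (h y - h x) <= e.
Proof.
move=> hc r1 e0.
pose c2 (p : R * R) : C := Complex p.1 p.2.
pose P (d : R) (p : R * R) := nm (c2 p) <= r -> forall y, nm y <= r ->
  nm (y - c2 p) < d -> nm (h y - h (c2 p)) <= e.
have cpt : compact (`[(-1 : R), 1]%classic `*` `[(-1 : R), 1]%classic).
  by apply: compact_setX; exact: segment_compact.
have loc x : exists2 d : R, 0 < d & forall x' d', nm (x' - x) < d -> d' < d ->
    nm x' <= r -> forall y, nm y <= r -> nm (y - x') < d' -> nm (h y - h x') <= e.
  have [x1|x1] := ltP (nm x) 1; last first.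
    (* Points of the square outside the open unit disk: the ball of radius 1 - r around them misses
       the disk of radius r, so the claim is vacuous. *)
    exists (1 - r); first by rewrite subr_gt0.
    move=> x' d' xx' _ x'r; have := nmBB x x'; rewrite nmBC; lra.
  have e2 : 0 < e / 2 by lra.
  have [d d0 Hd] := hc x x1 _ e2.
  exists (d / 2); first by lra.
  move=> x' d' xx' dd _ y _ yx'.
  have -> : h y - h x' = (h (x + (y - x)) - h x) - (h (x + (x' - x)) - h x).
    by rewrite !(addrC x) !subrK; ring.
  apply: le_trans (nmB _ _) _.
  have h1 : nm (y - x) < d.
    have -> : y - x = (y - x') + (x' - x) by ring.
    by apply: le_lt_trans (nmD _ _) _; lra.
  have h2 : nm (x' - x) < d by lra.
  have := Hd _ h1; have := Hd _ h2; lra.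
have cov : \forall d \near (0 : R)^'+, (`[(-1 : R), 1]%classic `*` `[(-1 : R), 1]%classic) `<=` P d.
  apply: (compact_near_coveringP _).1 cpt _ _ _ _ _ => -[a b] _.
  have [d d0 Hd] := loc (Complex a b).
  exists (ball (a, b) (d / 2), [set d' | d' < d]).
    split => /=; first by apply: nbhsx_ballx; lra.
    exact: nbhs_right_lt.
  move=> [[a' b'] d'] /= [[/= aa bb] dd] nr y yr yd.
  apply: (Hd (Complex a' b') d') => //.
  apply: le_lt_trans (nm_le_ReIm _) _ => /=.
  move: aa bb; rewrite /ball /= => aa bb.
  by rewrite distrC [X in _ + X]distrC; lra.
near (0 : R)^'+ => d.
exists d => // x y xr yr xy.
have := near cov d; rewrite /P => /(_ _ (complex.Re x, complex.Im x)).
have xE : c2 (complex.Re x, complex.Im x) = x by case: (x).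
rewrite xE; apply => //.
have := Re_le_nm x; have := Im_le_nm x; rewrite !ler_norml => Hi Hr.
by split; rewrite /= in_itv /=; lra.
Unshelve. all: by end_near.
Qed.

(** One d serves every base point x. It is the modulus of uniform continuity of h', since h' x
    differs from h' by at most e along the segment from x to y. *)
Lemma disk_strong_diff h (h' : C -> C) (r e : R) :
  (forall z, nm z < 1 -> cder h z (h' z)) -> (forall z, nm z < 1 -> ccont h' z) ->
  r < 1 -> 0 < e -> exists2 d : R, 0 < d &
  forall x y, nm x <= r -> nm y <= r -> nm (y - x) < d ->
    nm (h y - h x - h' x * (y - x)) <= e * nm (y - x).
Proof.
move=> hd hc r1 e0; have [d d0 Hd] := disk_unif_cont hc r1 e0.
exists d => // x y xr yr xy.
have S := on_seg_disk xr yr.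
apply: seg_diff_le => t t01; first by apply: hd; exact: le_lt_trans (S t t01) r1.
apply: Hd => //; first exact: S.
rewrite addrC addKr nmM nm_real; apply: le_lt_trans xy.
move: t01 => /andP[t0 t1]; rewrite ger0_norm// -[leRHS]mul1r ler_wpM2r ?nm_ge0//.
Qed.

End MeanValue.

(** * Roots of unity, discrete circle means and limits of sequences *)

Section RootsOfUnity.
Variable R : realType.
Local Notation C := R[i].

Definition expi (t : R) : C := Complex (cos t) (sin t).

Lemma expiD (s t : R) : expi (s + t) = expi s * expi t.
Proof. by rewrite /expi sinD cosD /GRing.mul /= addrC; congr Complex; rewrite addrC // [RHS]addrC. Qed.

Lemma expi0 : expi 0 = 1. Proof. by rewrite /expi cos0 sin0. Qed.

Lemma expiX (t : R) n : expi t ^+ n = expi (n%:R * t).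
Proof.
elim: n => [|n IH]; first by rewrite mul0r expi0.
by rewrite exprS IH -expiD -natr1 mulrDl mul1r addrC.
Qed.

Lemma nm_expi (t : R) : nm (expi t) = 1.
Proof. by rewrite /= cos2Dsin2 sqrtr1. Qed.

(** By the half-angle formula, cos t = 1 would force sin(t/2) = 0, while t/2 lies in (0, pi). *)
Lemma expi_neq1 (t : R) : 0 < t < pi *+ 2 -> expi t != 1.
Proof.
move=> /andP[t0 t2]; apply/negP => /eqP[].
have -> : t = t / 2 + t / 2 by field.
rewrite cosD => c1 _.
have s0 : 0 < sin (t / 2) by apply: sin_gt0_pi; move: t2; rewrite mulr2n; lra.
have := cos2Dsin2 (t / 2); nra.
Qed.

Lemma expi_near1 (e : R) : 0 < e -> exists2 d : R, 0 < d &
  forall t, `|t| < d -> nm (expi t - 1) < e.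
Proof.
move=> e0; have e2 : 0 < e / 2 by lra.
have [d1 d10 H1] := (nbhs_ballP _ _).1 ((cvgrPdist_lt _ _).1 (@continuous_cos R 0) _ e2).
have [d2 d20 H2] := (nbhs_ballP _ _).1 ((cvgrPdist_lt _ _).1 (@continuous_sin R 0) _ e2).
exists (Num.min d1 d2); first by rewrite lt_min d10.
move=> t; rewrite lt_min => /andP[td1 td2].

apply: le_lt_trans (nm_le_ReIm _) _.
have := H1 t; have := H2 t; rewrite /ball /= sub0r normrN sin0 cos0 sub0r normrN.
move=> /(_ td2) h2 /(_ td1); rewrite distrC oppr0 addr0; lra.
Qed.

Definition zeta (n : nat) : C := expi (2 * pi / n%:R).

Lemma nm_zetaX n k : nm (zeta n ^+ k) = 1.
Proof. by rewrite nmX nm_expi expr1n. Qed.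

Lemma zeta_neq0 n k : zeta n ^+ k != 0.
Proof. by rewrite -nm_gt0 nm_zetaX. Qed.

Lemma zeta_expn n : (0 < n)%N -> zeta n ^+ n = 1.
Proof.
move=> n0; rewrite expiX mulrC divfK ?pnatr_eq0 -?lt0n//.
by rewrite /expi mulr_natl cos2pi sin2pi.
Qed.

Lemma zeta_neq1 n j : (0 < j < n)%N -> zeta n ^+ j != 1.
Proof.
move=> /andP[j0 jn]; rewrite expiX; apply: expi_neq1.
have n0 : (0 : R) < n%:R by rewrite ltr0n (ltn_trans j0).
have p0 := pi_gt0 R.
have J0 : (0 : R) < j%:R by rewrite ltr0n.
have jn' : (j%:R : R) < n%:R by rewrite ltr_nat.
apply/andP; split; first by rewrite mulr_gt0 ?divr_gt0 ?mulr_gt0.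
have -> : pi *+ 2 = 2 * pi :> R by rewrite mulr_natl.
rewrite mulrA ltr_pdivrMr//.
by rewrite mulrC ltr_pM2l ?mulr_gt0.
Qed.

Lemma zeta_near1 (e : R) : 0 < e -> exists N, forall n, (N <= n)%N -> nm (zeta n - 1) < e.
Proof.
move=> /expi_near1[d d0 Hd].
have p0 := pi_gt0 R.
exists (Num.truncn (2 * pi / d)).+1 => n Nn; apply: Hd.
have k : 2 * pi / d < n%:R.
  by apply: lt_le_trans (truncnS_gt _) _; rewrite ler_nat.
have n0 : (0 : R) < n%:R by apply: le_lt_trans k; rewrite divr_ge0// ?ltW// mulr_gt0.
rewrite ger0_norm; last by rewrite divr_ge0// ?ltW// mulr_gt0.
by rewrite ltr_pdivrMr// [ltRHS]mulrC -ltr_pdivrMr.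
Qed.

Lemma sum_zeta n j : (0 < j < n)%N -> \sum_(k < n) (zeta n ^+ j) ^+ k = 0.
Proof.
move=> jn; have z1 := zeta_neq1 jn.
have n0 : (0 < n)%N by case/andP: jn => _; exact: leq_trans.
have := subrX1 (zeta n ^+ j) n.
rewrite -exprM mulnC exprM zeta_expn// expr1n subrr => /esym/eqP.
by rewrite mulf_eq0 subr_eq0 (negPf z1) => /eqP.
Qed.

Lemma sum_zetaV n j : (0 < j < n)%N -> \sum_(k < n) (zeta n ^+ j) ^- k = 0.
Proof.
move=> jn; have z1 := zeta_neq1 jn.
have n0 : (0 < n)%N by case/andP: jn => _; exact: leq_trans.
have := subrX1 (zeta n ^+ j)^-1 n.
rewrite exprVn -exprM mulnC exprM zeta_expn// expr1n invr1 subrr => /esym/eqP.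
rewrite mulf_eq0 subr_eq0 invr_eq1 (negPf z1) /= => /eqP E.
by rewrite -[RHS]E; apply: eq_bigr => k _; rewrite exprVn.
Qed.

(** At the nodes of a circle this is the discrete form of (1/2pi) times the integral over the angle,
    that is, of (1/2 i pi) times the integral of F(z) dz/z. *)
Definition mean (n : nat) (F : nat -> C) : C := n%:R^-1 * \sum_(k < n) F k.

Lemma nm_mean n F (M : R) : (0 < n)%N -> (forall k, nm (F k) <= M) -> nm (mean n F) <= M.
Proof.
move=> n0 H; rewrite nmM nmV nm_nat ler_pdivrMl ?ltr0n//.
apply: le_trans (nm_sum _ _) _.
apply: le_trans (ler_sum _ (fun (k : 'I_n) _ => H k)) _.
by rewrite sumr_const card_ord mulr_natl.
Qed.

Lemma meanD n F G : mean n (fun k => F k + G k) = mean n F + mean n G.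
Proof. by rewrite /mean big_split mulrDr. Qed.

Lemma meanZ n c F : mean n (fun k => c * F k) = c * mean n F.
Proof. by rewrite /mean -mulr_sumr mulrCA. Qed.

Lemma eq_mean n F G : F =1 G -> mean n F = mean n G.
Proof. by move=> FG; rewrite /mean; congr (_ * _); apply: eq_bigr => k _. Qed.

Definition node (r : R) n k : C := r%:C * zeta n ^+ k.

Lemma nm_node r n k : 0 <= r -> nm (node r n k) = r.
Proof. by move=> r0; rewrite nmM nm_real nm_zetaX mulr1 ger0_norm. Qed.

Lemma mean_nodeX r n j : (0 < j < n)%N -> mean n (fun k => node r n k ^+ j) = 0.
Proof.
move=> jn.
under eq_mean do rewrite exprMn -exprM mulnC exprM.
by rewrite meanZ /mean sum_zeta// !mulr0.
Qed.

Definition clim (u : nat -> C) (l : C) := forall e : R, 0 < e ->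
  exists N, forall n, (N <= n)%N -> nm (u n - l) <= e.

Lemma climD u v l l' : clim u l -> clim v l' -> clim (fun n => u n + v n) (l + l').
Proof.
move=> H H' e e0; have e2 : 0 < e / 2 by lra.
have [N HN] := H _ e2; have [N' HN'] := H' _ e2.
exists (maxn N N') => n; rewrite geq_max => /andP[/HN h /HN' h'].
have -> : u n + v n - (l + l') = (u n - l) + (v n - l') by ring.
by apply: le_trans (nmD _ _) _; lra.
Qed.

Lemma climZ c u l : clim u l -> clim (fun n => c * u n) (c * l).
Proof.
move=> H e e0; have k0 : 0 < 1 + nm c by rewrite ltr_pwDl ?nm_ge0.
have [N HN] := H _ (divr_gt0 e0 k0); exists N => n /HN.
rewrite ler_pdivlMr// -mulrBr nmM => h.
have := nm_ge0 (u n - l); nra.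
Qed.

Lemma clim_cst c : clim (fun=> c) c.
Proof. by move=> e e0; exists 0%N => n _; rewrite subrr nm0 ltW. Qed.

Lemma clim_near u v l : (exists N, forall n, (N <= n)%N -> u n = v n) -> clim u l -> clim v l.
Proof.
move=> [N uv] H e e0; have [N' HN'] := H e e0.
by exists (maxn N N') => n; rewrite geq_max => /andP[/uv <- /HN'].
Qed.

Lemma clim_le u l (M : R) : clim u l -> (exists N, forall n, (N <= n)%N -> nm (u n) <= M) ->
  nm l <= M.
Proof.
move=> H [N HN]; apply/ler_addgt0Pr => e e0; have [N' HN'] := H e e0.
have := HN _ (leq_maxl N N'); have := HN' _ (leq_maxr N N').
set n := maxn _ _; have := nmBB l (u n); rewrite nmBC; lra.
Qed.

Lemma clim_uniq u l l' : clim u l -> clim u l' -> l = l'.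
Proof.
move=> H H'; apply/eqP; rewrite -subr_eq0 -nm_eq0 eq_le nm_ge0 andbT.
have := climD H (climZ (-1) H').
rewrite !mulN1r => /clim_le; apply; exists 0%N => n _.
by rewrite mulN1r subrr nm0.
Qed.

Local Open Scope classical_set_scope.

Lemma real_cauchy_lim (u : nat -> R) :
  (forall e : R, 0 < e -> exists N, forall n m, (N <= n)%N -> (N <= m)%N -> `|u n - u m| <= e) ->
  exists l, forall e : R, 0 < e -> exists N, forall n, (N <= n)%N -> `|u n - l| <= e.
Proof.
move=> H.
have cu : cvg (u @ \oo).
  apply: cauchy_cvg; apply: cauchy_exP => e e0.
  have e2 : 0 < e / 2 by lra.
  have [N HN] := H _ e2; exists (u N); exists N => // n /= Nn.
  by have := HN N n (leqnn N) Nn; rewrite /ball /=; lra.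
exists (lim (u @ \oo)) => e e0.
have [N _ HN] := (cvgrPdist_le _ _).1 cu _ e0.
by exists N => n Nn; rewrite distrC; exact: HN.
Qed.

Lemma clim_cauchy (u : nat -> C) :
  (forall e : R, 0 < e -> exists N, forall n m, (N <= n)%N -> (N <= m)%N -> nm (u n - u m) <= e) ->
  exists l, clim u l.
Proof.
move=> H.
have [a Ha] : exists l, forall e : R, 0 < e -> exists N, forall n, (N <= n)%N -> `|complex.Re (u n) - l| <= e.
  apply: real_cauchy_lim => e /H[N HN]; exists N => n m Nn Nm.
  by apply: le_trans (HN n m Nn Nm); rewrite -ReN -ReD Re_le_nm.
have [b Hb] : exists l, forall e : R, 0 < e -> exists N, forall n, (N <= n)%N -> `|complex.Im (u n) - l| <= e.
  apply: real_cauchy_lim => e /H[N HN]; exists N => n m Nn Nm.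
  apply: le_trans (HN n m Nn Nm).
  by have := Im_le_nm (u n - u m); case: (u n); case: (u m).
exists (Complex a b) => e e0; have e2 : 0 < e / 2 by lra.
have [N HN] := Ha _ e2; have [N' HN'] := Hb _ e2.
exists (maxn N N') => n; rewrite geq_max => /andP[/HN h /HN' h'].
apply: le_trans (nm_le_ReIm _) _.
by move: h h'; case: (u n) => x y /=; lra.
Qed.

Lemma geometric_small (q e : R) : 0 <= q < 1 -> 0 < e ->
  exists N, forall n, (N <= n)%N -> q ^+ n <= e.
Proof.
move=> /andP[q0 q1] e0.
have q1' : `|q| < 1 by rewrite ger0_norm.
have [N _ HN] := (cvgrPdist_le _ _).1 (cvg_expr q1') _ e0.
exists N => n Nn; have := HN n Nn; rewrite /= sub0r normrN.
by rewrite ger0_norm// exprn_ge0.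
Qed.

End RootsOfUnity.

(** * Cauchy's formula and higher derivatives *)

Section Cauchy.
Variable R : realType.
Local Notation C := R[i].

(** Walk from 0 to z along the radius in steps shorter than the d of uniform continuity: each step
    changes h by at most 1, and the number of steps is bounded in terms of r. *)
Lemma disk_bounded (h : C -> C) (r : R) : (forall z, nm z < 1 -> ccont h z) -> r < 1 ->
  exists2 M : R, 0 <= M & forall z, nm z <= r -> nm (h z) <= M.
Proof.
move=> hc r1; have [d d0 Hd] := disk_unif_cont hc r1 ltr01.
have step m z : nm z <= r -> nm z <= m%:R * (d / 2) -> nm (h z) <= nm (h 0) + m%:R.
  elim: m z => [|m IH] z zr.
    rewrite mul0r => z0; have /eqP : nm z == 0 by rewrite eq_le z0 nm_ge0.
    by move/eqP; rewrite nm_eq0 => /eqP ->; rewrite addr0.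
  have m1 : (0 : R) < m.+1%:R by rewrite ltr0n.
  have m0 : (0 : R) <= m%:R by rewrite ler0n.
  rewrite mulrC -ler_pdivrMr// => zd.
  pose y := (m%:R / m.+1%:R : R)%:C * z.
  have ny : nm y = m%:R * (nm z / m.+1%:R).
    by rewrite nmM nm_real ger0_norm ?divr_ge0// ?ltW// mulrAC mulrA.
  have yd : nm y <= m%:R * (d / 2) by rewrite ny ler_wpM2l.
  have yr : nm y <= r.
    apply: le_trans zr; rewrite ny mulrA ler_pdivrMr// mulrC ler_wpM2l ?nm_ge0//.
    by rewrite ler_nat.
  have zy : nm (z - y) < d.
    have -> : z - y = (m.+1%:R^-1 : R)%:C * z.
      rewrite /y -[X in X - _]mul1r -mulrBl -[1](rmorph1 (real_complex R)) -rmorphB /=.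
      congr (_%:C * _); rewrite -natr1; field.
      by rewrite natr1 gt_eqF.
    rewrite nmM nm_real ger0_norm ?invr_ge0 ?ltW// mulrC.
    by apply: le_lt_trans zd _; lra.
  rewrite -natr1 addrA; have := IH y yr yd; have := Hd y z yr zr zy.
  have := nmBB (h z) (h y); lra.
exists (nm (h 0) + (Num.truncn (r / (d / 2))).+1%:R); first by rewrite addr_ge0// nm_ge0.
move=> z zr; apply: step => //; rewrite -ler_pdivrMr ?divr_gt0//.
apply: le_trans (ltW (truncnS_gt _)); rewrite ler_pM2r// invr_gt0; lra.
Qed.

(** For one small fixed t, the quotient (K n (w + t) - K n w)/t approximates K' n w within M t for
    all n at once. Since the quotients converge, K' n w is Cauchy; the quadratic remainder bound
    then passes to the limit. *)
Lemma clim_cder (K K' : nat -> C -> C) (H : C -> C) (w : C) (d M : R) :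
  0 < d -> 0 <= M ->
  (forall n u, (0 < n)%N -> nm u < d -> nm (K n (w + u) - K n w - K' n w * u) <= M * nm u ^+ 2) ->
  (forall u, nm u < d -> clim (K^~ (w + u)) (H (w + u))) ->
  exists2 l, clim (K'^~ w) l & cder H w l.
Proof.
move=> d0 M0 HK HH.
have HD u : nm u < d -> clim (fun n => K n (w + u) - K n w) (H (w + u) - H w).
  move=> ud; rewrite -mulN1r; under [X in clim X]funext do rewrite -[X in _ + X]mulN1r.
  apply: climD; first exact: HH.
  by apply: climZ; have := HH 0; rewrite addr0; apply; rewrite nm0.
have [l Hl] : exists l, clim (K'^~ w) l.
  apply: clim_cauchy => e e0.
  have k0 : 0 < 4 * (1 + M) by lra.
  (* M t <= e/4 bounds the two remainders and N is chosen so that the two distances to the limit are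
     at most e/4 t: four errors add up to e t. *)
  set t := Num.min (d / 2) (e / (4 * (1 + M))).
  have t0 : 0 < t by rewrite lt_min !divr_gt0.
  have td : t < d.
    by apply: (@le_lt_trans _ _ (d / 2)); [rewrite ge_min lexx|lra].
  have tM : M * t <= e / 4.
    have : t <= e / (4 * (1 + M)) by rewrite ge_min lexx orbT.
    by rewrite ler_pdivlMr//; lra.
  have nt : nm t%:C = t by rewrite nm_real gtr0_norm.
  have et : 0 < e / 4 * t by rewrite mulr_gt0// divr_gt0.
  have ud : nm t%:C < d by rewrite nt.
  have [N HN] := HD _ ud _ et.
  exists (maxn 1 N) => n m; rewrite !geq_max => /andP[n0 nN] /andP[m0 mN].
  rewrite -(ler_pM2l t0) -{1}nt -nmM.
  have := HN n nN; have := HN m mN; have := HK n _ n0 ud; have := HK m _ m0 ud.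
  set L := H _ - H _; set Dn := K n _ - K n _; set Dm := K m _ - K m _.
  rewrite nt => h1 h2 h3 h4.
  have -> : t%:C * (K' n w - K' m w) = ((Dm - K' m w * t%:C) - (Dn - K' n w * t%:C))
      + ((Dn - L) - (Dm - L)) by ring.
  apply: le_trans (nmD _ _) _.
  have g1 := nmB (Dm - K' m w * t%:C) (Dn - K' n w * t%:C).
  have g2 := nmB (Dn - L) (Dm - L).
  have : M * t ^+ 2 <= e / 4 * t by rewrite expr2 mulrA ler_wpM2r// ltW.
  lra.
exists l => //.
have key u : nm u < d -> nm (H (w + u) - H w - l * u) <= M * nm u ^+ 2.
  move=> ud; apply: (@clim_le _ (fun n => K n (w + u) - K n w + (- u) * K' n w)).
    have -> : H (w + u) - H w - l * u = H (w + u) - H w + (- u) * l by ring.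
    by apply: climD; [exact: HD|exact: climZ].
  by exists 1%N => n n0; rewrite mulNr [u * _]mulrC; apply: HK.
move=> e e0; exists (Num.min d (e / (1 + M))).
  by rewrite lt_min d0 divr_gt0//; lra.
move=> u; rewrite lt_min => /andP[ud]; rewrite ltr_pdivlMr; last by lra.
move=> ue; apply: le_trans (key u ud) _; rewrite expr2 mulrA.
by apply: ler_wpM2r; rewrite ?nm_ge0//; have := nm_ge0 u; lra.
Qed.

(** The relation p - q = u p q is the resolvent identity of p = 1/(y - w - u) and q = 1/(y - w). The
    lemma is thus the expansion of (y - w)^(-j) in w, with a remainder constant that does not depend
    on the node y. *)
Lemma inv_pow_expansion (D : R) (j : nat) : 0 <= D -> exists2 B : R, 0 <= B &
  forall p q u : C, p - q = u * p * q -> nm p <= D -> nm q <= D ->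
  nm (p ^+ j - q ^+ j - j%:R * u * q ^+ j.+1) <= B * nm u ^+ 2.
Proof.
move=> D0; elim: j => [|j [B B0 IH]].
  exists 0 => // p q u _ _ _.
  by rewrite !expr0 mulr0n !mul0r subrr subr0 nm0 lexx.
have D3 : 0 <= D ^+ j.+3 by exact: exprn_ge0.
exists (D * B + j.+1%:R * D ^+ j.+3).
  by rewrite addr_ge0// mulr_ge0.
move=> p q u pq pD qD.
have -> : p ^+ j.+1 - q ^+ j.+1 - j.+1%:R * u * q ^+ j.+2 =
   p * (p ^+ j - q ^+ j - j%:R * u * q ^+ j.+1) + j.+1%:R * (u ^+ 2 * p * q ^+ j.+2).
  rewrite !exprS -natr1.
  (* Each substitution of p - q = u p q gains one factor u: first in the terms of order 0 and 1,
     then in the u (p - q) that is left over. *)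
  transitivity (p * (p ^+ j - q ^+ j - j%:R * u * (q * q ^+ j)) + (p - q) * q ^+ j
     + j%:R * u * q * q ^+ j * (p - q) - u * (q * (q * q ^+ j))); first by ring.
  rewrite pq; transitivity (p * (p ^+ j - q ^+ j - j%:R * u * (q * q ^+ j))
     + u * (p - q) * q * q ^+ j + j%:R * u * q * q ^+ j * (u * p * q)); first by ring.
  by rewrite pq; ring.
apply: le_trans (nmD _ _) _; rewrite mulrDl; apply: lerD.
  rewrite nmM -[leRHS]mulrA; apply: ler_pM; rewrite ?nm_ge0//; exact: IH.
rewrite nmM (nmM (u ^+ 2 * p)) (nmM (u ^+ 2)) !nmX nm_nat -[leRHS]mulrA ler_wpM2l// -mulrA.
rewrite [leRHS]mulrC; apply: ler_wpM2l; first by rewrite exprn_ge0// nm_ge0.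
rewrite [leRHS]exprS; apply: ler_pM; rewrite ?exprn_ge0 ?nm_ge0//.
by rewrite lerXn2r// nnegrE// nm_ge0.
Qed.

Section Disk.
Variables (h h' : C -> C).
Hypothesis hd : forall z, nm z < 1 -> cder h z (h' z).
Hypothesis h'c : forall z, nm z < 1 -> ccont h' z.

Section Radius.
Variable r : R.
Hypothesis r01 : 0 < r < 1.

Let r0 : 0 < r. Proof. by case/andP: r01. Qed.
Let r1 : r < 1. Proof. by case/andP: r01. Qed.

Local Notation nd := (node r).

Lemma node_neq w n k : nm w < r -> nd n k - w != 0.
Proof.
move=> wr; rewrite -nm_gt0; have := nmBB (nd n k) w.
by rewrite nm_node ?(ltW r0)//; move: r0 wr; lra.
Qed.

Lemma nodeS n k : nd n k.+1 - nd n k = (zeta R n - 1) * nd n k.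
Proof. by rewrite /node exprS; ring. Qed.

(* The circle sum of h' vanishes in the limit, because it is a telescoping sum
   of increments of h up to a relative error bounded by strong differentiability. *)
Lemma mean_derivative_small w (e : R) : nm w < r -> 0 < e ->
  exists N, forall n (s : R), (N <= n)%N -> 0 <= s <= 1 ->
  nm (mean n (fun k => h' (w + s%:C * (nd n k - w)) * nd n k)) <= e.
Proof.
move=> wr e0.
have [d d0 Hd] := disk_strong_diff hd h'c r1 (divr_gt0 e0 r0).
have [N HN] := zeta_near1 (divr_gt0 d0 r0).
(* N makes the steps |x_{k+1} - x_k| smaller than d; n >= 2 makes the nodes sum to 0, which settles
   s = 0, where all points x_k collapse to w. *)
exists (maxn N 2) => n s; rewrite geq_max => /andP[/HN zd n2] s01.
have n0 : (0 < n)%N by exact: leq_trans n2.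
have [->|s0] := eqVneq s 0.
  under eq_mean do rewrite mul0r addr0.
  rewrite meanZ (_ : mean _ _ = 0); first by rewrite mulr0 nm0 ltW.
  rewrite -[RHS](@mean_nodeX _ r n 1) //.
have {s0} s0 : 0 < s by rewrite lt_neqAle eq_sym s0; case/andP: s01.
have s1 : s <= 1 by case/andP: s01.
pose x k := w + s%:C * (nd n k - w).
have xr k : nm (x k) <= r.
  by apply: (@on_seg_disk R r w (nd n k)); rewrite ?nm_node ?(ltW r0)// ltW.
have xS k : x k.+1 - x k = s%:C * ((zeta R n - 1) * nd n k).
  by rewrite -nodeS /x; ring.
have z1 : zeta R n != 1 by rewrite -[zeta R n]expr1 zeta_neq1.
have nx k : nm (x k.+1 - x k) = s * nm (zeta R n - 1) * r.
  by rewrite xS nmM (nmM (zeta R n - 1)) nm_real nm_node ?(ltW r0)// gtr0_norm// mulrA.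
have zp : 0 < nm (zeta R n - 1) by rewrite nm_gt0 subr_eq0.
have tel : \sum_(k < n) (h (x k.+1) - h (x k)) = 0.
  have := telescope_sumr (fun k => h (x k)) (leq0n n).
  rewrite big_mkord => ->.
  by rewrite /x /node zeta_expn// expr0 subrr.
have E : s%:C * (zeta R n - 1) * (\sum_(k < n) h' (x k) * nd n k) =
    - (\sum_(k < n) (h (x k.+1) - h (x k) - h' (x k) * (x k.+1 - x k))).
  rewrite sumrB tel sub0r opprK mulr_sumr; apply: eq_bigr => k _.
  by rewrite xS; ring.
have : nm (s%:C * (zeta R n - 1) * (\sum_(k < n) h' (x k) * nd n k)) <=
    n%:R * (e / r * (s * nm (zeta R n - 1) * r)).
  rewrite E nmN; apply: le_trans (nm_sum _ _) _.
  have le k : nm (h (x k.+1) - h (x k) - h' (x k) * (x k.+1 - x k)) <=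
      e / r * (s * nm (zeta R n - 1) * r).
    rewrite -(nx k); apply: Hd => //; rewrite nx.
    rewrite -ltr_pdivlMr//; apply: le_lt_trans zd.
    by rewrite -[leRHS]mul1r ler_wpM2r// nm_ge0.
  apply: le_trans (ler_sum _ (fun (k : 'I_n) _ => le k)) _.
  by rewrite sumr_const card_ord mulr_natl.
move=> hS; rewrite /mean nmM nmV nm_nat ler_pdivrMl ?ltr0n//; move: hS.
rewrite nmM (nmM _ (zeta R n - 1)) nm_real gtr0_norm//.
have -> : n%:R * (e / r * (s * nm (zeta R n - 1) * r)) =
   s * nm (zeta R n - 1) * (n%:R * e) by field; rewrite gt_eqF.
by rewrite ler_pM2l// mulr_gt0.
Qed.

(** The mean A is known exactly: A (1 - (w/r)^n) = 1. Since node^n = r^n, each term times 1 -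
    (w/r)^n is the geometric sum of (w/node)^j over j < n, and averaging kills every j > 0. *)
Lemma mean_kernel1 w : nm w < r -> clim (fun n => mean n (fun k => nd n k / (nd n k - w))) 1.
Proof.
move=> wr e e0.
set q := nm w / r.
have q01 : 0 <= q < 1 by rewrite /q divr_ge0 ?nm_ge0 ?(ltW r0)//= ltr_pdivrMr// mul1r.
have rw : 0 < r - nm w by lra.
have e1 : 0 < e / (r / (r - nm w)) by rewrite !divr_gt0.
have [N HN] := geometric_small q01 e1.
exists (maxn N 1) => n; rewrite geq_max => /andP[/HN qn n0].
set A := mean n _.
have nA : nm A <= r / (r - nm w).
  apply: nm_mean => // k; rewrite nmM nmV nm_node ?(ltW r0)//.
  rewrite ler_pM2l// lef_pV2 ?posrE// ?nm_gt0 ?node_neq//.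
  by have := nmBB (nd n k) w; rewrite nm_node ?(ltW r0).
have rC : r%:C != 0 :> C by rewrite -nm_gt0 nm_real normr_gt0 gt_eqF.
have ndn k : nd n k != 0 by rewrite mulf_neq0// zeta_neq0.
have E : A * (1 - (w / r%:C) ^+ n) = 1.
  have Ek k : nd n k / (nd n k - w) * (1 - (w / r%:C) ^+ n) = \sum_(j < n) (w / nd n k) ^+ j.
    have w1 : w / nd n k - 1 != 0.
      by rewrite -(divff (ndn k)) -mulrBl mulf_neq0 ?invr_neq0// -opprB oppr_eq0 node_neq.
    apply: (mulfI w1); rewrite -subrX1.
    have -> : (w / nd n k) ^+ n = (w / r%:C) ^+ n.
      rewrite !expr_div_n; congr (_ / _).
      by rewrite exprMn -exprM mulnC exprM zeta_expn// expr1n mulr1.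
    move: ((w / r%:C) ^+ n) => X; move: (ndn k) (node_neq n k wr); move: (nd n k) => y y0 yw.
    by field; rewrite y0 yw.
  rewrite /A /mean -mulrA mulr_suml.
  under eq_bigr do rewrite Ek.
  rewrite exchange_big /=.
  have n0' : n%:R != 0 :> C by rewrite pnatr_eq0 -lt0n.
  apply: (mulfI n0'); rewrite mulrA divff// mul1r mulr1.
  case: n n0 {qn nA A ndn Ek n0'} => // n _.
  rewrite big_ord_recl [X in _ + X]big1 ?addr0.
    under eq_bigr do rewrite expr0.
    by rewrite sumr_const card_ord.
  move=> j _; under eq_bigr do rewrite expr_div_n exprMn -exprM mulnC exprM invfM.
  by rewrite -mulr_sumr -mulr_sumr sum_zetaV ?mulr0//= /bump add1n ltnS ltn_ord.
have -> : A - 1 = A * (w / r%:C) ^+ n.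
  by move: E; rewrite mulrBr mulr1 => <-; ring.
rewrite nmM nmX (nmM w) nmV nm_real (gtr0_norm r0) -/q.
have : r / (r - nm w) * q ^+ n <= e.
  by rewrite mulrC -ler_pdivlMr// divr_gt0.
apply: le_trans; apply: ler_wpM2r => //.
by rewrite exprn_ge0//; case/andP: q01.
Qed.

(** Contract the circle to w by s -> w + s (node - w). In the s-derivative of the Cauchy sum [phi],
    the factor node - w cancels the denominator and leaves a mean of h' times the node, small
    uniformly in s. So phi 1, the Cauchy sum, is close to phi 0 = h w times the mean of the kernel,
    which tends to 1. *)
Lemma cauchy_formula w : nm w < r ->
  clim (fun n => mean n (fun k => h (nd n k) * nd n k / (nd n k - w))) (h w).
Proof.
move=> wr.
set K := fun n => mean n _.
pose A n := mean n (fun k => nd n k / (nd n k - w)).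
have KA : clim (fun n => K n - h w * A n) 0.
  move=> e e0; have [N HN] := mean_derivative_small wr e0.
  exists N => n Nn; rewrite subr0.
  pose phi s := mean n (fun k => h (w + s * (nd n k - w)) * (nd n k / (nd n k - w))).
  pose dphi s := mean n (fun k => h' (w + s * (nd n k - w)) * nd n k).
  have D : on_seg (fun s => cder phi s (dphi s)) 0 1.
    move=> t t01; rewrite add0r subr0 mulr1.
    apply: cderZ; apply: cder_sum => k.
    have -> : h' (w + t%:C * (nd n k - w)) * nd n k =
       (h' (w + t%:C * (nd n k - w)) * (nd n k - w)) * (nd n k / (nd n k - w)) +
       h (w + t%:C * (nd n k - w)) * 0 by field; rewrite node_neq.
    apply: cderM; last exact: cder_cst.
    apply: (@cder_comp _ (fun s => w + s * (nd n k - w)) h).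
      have := cderD (cder_cst w t%:C) (cderM (cder_id t%:C) (cder_cst (nd n k - w) t%:C)).
      by rewrite /= mulr0 addr0 add0r mul1r.
    apply: hd; apply: le_lt_trans r1.
    by apply: (@on_seg_disk R r w (nd n k)); rewrite ?nm_node ?(ltW r0)// ltW.
  have := @seg_diff_le R phi dphi 0 e 0 1 D.
  rewrite subr0 mul0r subr0 nm1 mulr1.
  have -> : phi 1 - phi 0 = K n - h w * A n.
    congr (_ - _).
      by apply: eq_mean => k; rewrite mul1r (addrC w) subrK mulrA.
    by rewrite /A -meanZ; apply: eq_mean => k; rewrite mul0r addr0.
  apply => t t01; rewrite add0r !subr0 mulr1; exact: HN.
have := climD KA (climZ (h w) (mean_kernel1 wr)); rewrite add0r mulr1.
apply: clim_near; exists 0%N => n _.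
by rewrite subrK.
Qed.

(** Discrete form of (1/2 i pi) times the integral of h(y) (y - w)^(-j) dy; the extra factor node
    comes from dy = i y dtheta. *)
Definition kern j n w := mean n (fun k => h (nd n k) * nd n k * (nd n k - w) ^- j).

(** The remainder of the expansion of the kernel is bounded uniformly in n, because h is bounded on
    the circle and the nodes stay away from w + u; hence limits of kernels may be differentiated in
    w. *)
Lemma kern_derivative j (H : C -> C) w :
  (forall w, nm w < r -> clim (fun n => kern j n w) (H w)) -> nm w < r ->
  exists2 l, clim (fun n => j%:R * kern j.+1 n w) l & cder H w l.
Proof.
move=> KH wr.
have hc z : nm z < 1 -> ccont h z by move=> z1; apply: ccont_cder (hd z1).
have [M M0 HM] := disk_bounded hc r1.
(* Half the distance from w to the circle, so that w + u keeps distance at least d from every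
   node. *)
set d := (r - nm w) / 2.
have d0 : 0 < d by rewrite /d; lra.
have [B B0 HB] : exists2 B : R, 0 <= B &
  forall p q u : C, p - q = u * p * q -> nm p <= d^-1 -> nm q <= d^-1 ->
  nm (p ^+ j - q ^+ j - j%:R * u * q ^+ j.+1) <= B * nm u ^+ 2.
  by apply: inv_pow_expansion; rewrite invr_ge0 ltW.
have inR u : nm u < d -> nm (w + u) < r.
  by move=> ud; apply: le_lt_trans (nmD _ _) _; move: ud; rewrite /d; lra.
have far u n k : nm u < d -> nm (nd n k - (w + u))^-1 <= d^-1.
  move=> ud; have wur := inR u ud.
  rewrite nmV lef_pV2 ?posrE// ?nm_gt0 ?node_neq//.
  have := nmBB (nd n k) (w + u); have := nmD w u.
  by rewrite nm_node ?(ltW r0)//; move: ud; rewrite /d; lra.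
apply: (@clim_cder (kern j) (fun n w => j%:R * kern j.+1 n w) H w d (M * r * B)) => //.
- by rewrite !mulr_ge0// ltW.
- move=> n u n0 ud.
  have -> : kern j n (w + u) - kern j n w - j%:R * kern j.+1 n w * u =
    mean n (fun k => h (nd n k) * nd n k * ((nd n k - (w + u))^-1 ^+ j
       - (nd n k - w)^-1 ^+ j - j%:R * u * (nd n k - w)^-1 ^+ j.+1)).
    have -> : kern j n (w + u) - kern j n w - j%:R * kern j.+1 n w * u =
      kern j n (w + u) + (-1) * kern j n w + (- (j%:R * u)) * kern j.+1 n w by ring.
    rewrite /kern -!meanZ -!meanD; apply: eq_mean => k.
    by rewrite !exprVn; ring.
  apply: nm_mean => // k.
  have u0 : nm (0 : C) < d by rewrite nm0.
  rewrite nmM (nmM (h _)) nm_node ?(ltW r0)// -[leRHS]mulrA.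
  apply: ler_pM; rewrite ?mulr_ge0 ?nm_ge0 ?(ltW r0)//.
    by apply: ler_wpM2r; [exact: ltW|apply: HM; rewrite nm_node// ltW].
  apply: HB; [|exact: far|by have := far 0 n k u0; rewrite addr0].
  have := node_neq n k wr; have := node_neq n k (inR u ud).
  by move: (nd n k) => y y1 y2; field; rewrite y2.
- by move=> u ud; apply: KH; exact: inR.
Qed.

(** Three differentiations, from j = 1, 2 and 3. The limit for j = 1 is h by Cauchy's formula,
    uniqueness of the derivative identifies the next one as h', and the factor j = 2 produces the
    division by 2. *)
Lemma kern_limits w : nm w < r ->
  [/\ clim (fun n => kern 2 n w) (h' w),
     clim (fun n => kern 3 n w) (derive1 (h' : CC R -> CC R) w / 2),
     cder h' w (derive1 (h' : CC R -> CC R) w) &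
     exists l, cder (derive1 (h' : CC R -> CC R)) w l].
Proof.
have K1 v : nm v < r -> clim (fun n => kern 1 n v) (h v).
  move=> vr; apply: clim_near (cauchy_formula vr); exists 0%N => n _.
  by apply: eq_mean => k; rewrite expr1.
have K2 v : nm v < r -> clim (fun n => kern 2 n v) (h' v).
  move=> vr; have [l Hl /cder_uniq El] := kern_derivative K1 vr.
  rewrite -(El _ (hd (lt_trans vr r1))).
  by apply: clim_near Hl; exists 0%N => n _; rewrite mul1r.
have K3 v : nm v < r -> clim (fun n => kern 3 n v) (derive1 (h' : CC R -> CC R) v / 2)
    /\ cder h' v (derive1 (h' : CC R -> CC R) v).
  move=> vr; have [l Hl D] := kern_derivative K2 vr.
  rewrite (cder_derive1 D); split => //.
  have := climZ 2^-1 Hl; rewrite mulrC; apply: clim_near; exists 0%N => n _.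
  by rewrite mulrA mulVf ?mul1r// pnatr_eq0.
move=> wr; split; [exact: K2|by case: (K3 w wr)|by case: (K3 w wr)|].
have [l _ D] := kern_derivative (fun v vr => (K3 v vr).1) wr.
exists (2 * l); apply: (cder_ext _ (cderZ 2 D)) => v.
by rewrite mulrCA divff ?mulr1// pnatr_eq0.
Qed.

End Radius.

Lemma C1_holo_C3 w : nm w < 1 ->
  cder h' w (derive1 (h' : CC R -> CC R) w) /\ exists l, cder (derive1 (h' : CC R -> CC R)) w l.
Proof.
move=> w1; have r01 : 0 < (1 + nm w) / 2 < 1 by have := nm_ge0 w; lra.
by have [] := kern_limits r01 (w := w); first lra.
Qed.

Lemma coef_means (r : R) : 0 < r < 1 ->
  [/\ clim (fun n => mean n (fun k => h (node r n k))) (h 0),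
     clim (fun n => mean n (fun k => h (node r n k) / node r n k)) (h' 0) &
     clim (fun n => mean n (fun k => h (node r n k) / node r n k ^+ 2))
       (derive1 (h' : CC R -> CC R) 0 / 2)].
Proof.
move=> r01; have r0 : 0 < r by case/andP: r01.
have w0 : nm (0 : C) < r by rewrite nm0.
have ndn n k : node r n k != 0 by rewrite -nm_gt0 nm_node// ltW.
have [K2 K3 _ _] := kern_limits r01 w0.
split.
- apply: clim_near (cauchy_formula r01 w0); exists 0%N => n _; apply: eq_mean => k.
  by rewrite subr0 mulfK.
- apply: clim_near K2; exists 0%N => n _; apply: eq_mean => k.
  by rewrite subr0; field.
- apply: clim_near K3; exists 0%N => n _; apply: eq_mean => k.
  by rewrite subr0; field.
Qed.

End Disk.
End Cauchy.

(** * Sharp bound on the second coefficient of a bounded function *)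

Section SecondCoefficient.
Variable R : realType.
Local Notation C := R[i].

Lemma sqr_nmD (z w : C) : nm (z + w) ^+ 2 = nm z ^+ 2 + nm w ^+ 2 + 2 * complex.Re (z^*%C * w).
Proof. by rewrite !nm_sq; case: z => a b; case: w => c d /=; ring. Qed.

(** Parseval for 1 + c z: the cross term averages to 0 because the nodes sum to 0 as soon as n >
    1. *)
Lemma mean_sqr_nm (r : R) (c : C) n : 0 < r -> (1 < n)%N ->
  n%:R^-1 * \sum_(k < n) nm (1 + c * node r n k) ^+ 2 = 1 + nm c ^+ 2 * r ^+ 2.
Proof.
move=> r0 n1; have n0 : (n%:R : R) != 0 by rewrite pnatr_eq0; case: n n1.
have E (k : 'I_n) : nm (1 + c * node r n k) ^+ 2 = (1 + nm c ^+ 2 * r ^+ 2) +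
    2 * complex.Re (c * node r n k).
  by rewrite sqr_nmD nm1 expr1n conjc1 mul1r nmM nm_node ?exprMn// ltW.
under eq_bigr do rewrite E.
rewrite big_split /= sumr_const card_ord -mulr_sumr.
have -> : \sum_(k < n) complex.Re (c * node r n k) = complex.Re (c * \sum_(k < n) node r n k).
  rewrite mulr_sumr; elim/big_ind2 : _ => // x y z w -> ->.
  by rewrite ReD.
have n0C : (n%:R : C) != 0 by rewrite pnatr_eq0; case: n n1 {n0 E}.
have -> : \sum_(k < n) node r n k = 0 :> C.
  have /eqP := @mean_nodeX R r n 1 n1.
  rewrite /mean mulf_eq0 invr_eq0 (negPf n0C) /= => /eqP S.
  by rewrite -[RHS]S.
rewrite mulr0 /= mulr0 addr0; move: (1 + _ * _) => X.
by rewrite -(mulr_natl X n) mulrA mulVf// mul1r.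
Qed.

(* The kernel [(1 + c zeta)^2 / zeta^2] extracts [c2 + 2 c c1], and its mean modulus on
   the circle is [(1 + |c|^2 r^2) / r^2]. Optimising over c gives the sharp bound. *)
Lemma second_coef_bound (h : C -> C) (h' : C -> C) :
  (forall z, nm z < 1 -> cder h z (h' z)) -> (forall z, nm z < 1 -> ccont h' z) ->
  (forall z, nm z < 1 -> nm (h z) <= 1) -> h 0 = 0 ->
  nm (derive1 (h' : CC R -> CC R) 0 / 2) + nm (h' 0) ^+ 2 <= 1.
Proof.
move=> hd hc h1 h0; set c2 := _ / 2; set c1 := h' 0.
have [u u1 uE] := exists_phase c2.
(* This c aligns the phases of c2 and 2 c c1, so their moduli add up to |c2| + 2 |c1|^2, while |c| =
   |c1|. The kernel bound r^(-2) + |c1|^2 then leaves (|c2| + |c1|^2) r^2 <= 1. *)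
pose c : C := c1^*%C * u^-1.
have u0 : u != 0 by rewrite -nm_gt0 u1.
have nc : nm c = nm c1.
  rewrite nmM nmV u1 invr1 mulr1; apply/(@complexI R).
  by rewrite -!normr_nm normcJ.
have cE : nm (c2 + 2 * c * c1) = nm c2 + 2 * nm c1 ^+ 2.
  have cc : c1^*%C * c1 = (nm c1 ^+ 2)%:C by rewrite mulrC -sqr_normc normr_nm rmorphXn.
  have -> : c2 + 2 * c * c1 = u^-1 * ((nm c2)%:C + 2 * (c1^*%C * c1)).
    by rewrite -uE /c; field.
  rewrite cc -[2](rmorph_nat (real_complex R) 2) -rmorphM -rmorphD /=.
  rewrite nmM nmV u1 invr1 mul1r nm_real ger0_norm//.
  by rewrite addr_ge0 ?nm_ge0// mulr_ge0// exprn_ge0// nm_ge0.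
have key (r : R) : 0 < r < 1 -> (nm c2 + nm c1 ^+ 2) * r ^+ 2 <= 1.
  move=> r01; have r0 : 0 < r by case/andP: r01.
  have [K0 K1 K2] := coef_means hd hc r01.
  have := climD (climD K2 (climZ (2 * c) K1)) (climZ (c ^+ 2) K0).
  rewrite h0 mulr0 addr0 => K.
  have ndn n k : node r n k != 0 :> C by rewrite -nm_gt0 nm_node// ltW.
  have : nm (c2 + 2 * c * c1) <= r ^- 2 * (1 + nm c ^+ 2 * r ^+ 2).
    apply: (clim_le K); exists 2%N => n n2.
    have n0 : (0 < n)%N by exact: leq_trans n2.
    rewrite -!meanZ -!meanD.
    rewrite -(mean_sqr_nm c r0 n2) /mean nmM nmV nm_nat [leRHS]mulrCA ler_pM2l ?invr_gt0 ?ltr0n//.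
    apply: le_trans (nm_sum _ _) _; rewrite mulr_sumr; apply: ler_sum => k _.
    have -> : h (node r n k) / node r n k ^+ 2 + 2 * c * (h (node r n k) / node r n k) +
      c ^+ 2 * h (node r n k) = h (node r n k) * ((1 + c * node r n k) ^+ 2 / node r n k ^+ 2).
      by move: (ndn n k); move: (node r n k) => y y0; field.
    rewrite nmM (nmM (_ ^+ 2)) nmV !nmX nm_node ?(ltW r0)// mulrA [leRHS]mulrC.
    apply: ler_wpM2r; first by rewrite invr_ge0 exprn_ge0// ltW.
    rewrite -[leRHS]mul1r ler_wpM2r ?exprn_ge0 ?nm_ge0// h1// nm_node ?(ltW r0)//.
    by case/andP: r01.
  rewrite cE nc ler_pdivlMl ?exprn_gt0// => H; lra.
have S0 : 0 <= nm c2 + nm c1 ^+ 2 by rewrite addr_ge0 ?nm_ge0// exprn_ge0 ?nm_ge0.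
rewrite leNgt; apply/negP; set S := _ + _ in key S0 * => S1.
(* This replaces letting r tend to 1: for r = (1 + t)/2 the bound S r^2 <= 1 reads ((1 + t)/2)^2 <=
   t, that is (1 - t)^2 <= 0. *)
set t := S^-1; have S0' : 0 < S by lra.
have t0 : 0 < t by rewrite invr_gt0.
have t1 : t < 1 by rewrite invf_lt1.
have := key ((1 + t) / 2); have -> : 0 < (1 + t) / 2 < 1 by lra.
move=> /(_ isT); rewrite -ler_pdivlMl// mulr1 -/t; nra.
Qed.

End SecondCoefficient.

(** * Primitives as limits of Riemann sums along radii *)

Section Primitive.
Variable R : realType.
Local Notation C := R[i].
Variables (G G' : C -> C).
Hypothesis Gd : forall z, nm z < 1 -> cder G z (G' z).
Hypothesis G'c : forall z, nm z < 1 -> ccont G' z.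

Let Gc z : nm z < 1 -> ccont G z. Proof. by move=> z1; apply: ccont_cder (Gd z1). Qed.

(** [Fn] is the left Riemann sum of the integral of G along the radius from 0 to w, and [dFn] its
    derivative in w. *)
Let pt n (w : C) k : C := (k%:R / n%:R : R)%:C * w.
Let Fn n w := mean n (fun k => w * G (pt n w k)).
Let dFn n w := mean n (fun k => G (pt n w k) + (k%:R / n%:R : R)%:C * w * G' (pt n w k)).

Let nm_pt n w k : (k <= n)%N -> nm (pt n w k) <= nm w.
Proof.
move=> kn; rewrite nmM nm_real ger0_norm ?divr_ge0//.
rewrite -[leRHS]mul1r ler_wpM2r ?nm_ge0//.
case: n kn => [|n] kn; first by rewrite invr0 mulr0.
by rewrite ler_pdivrMr ?ltr0n// mul1r ler_nat.
Qed.

Let Fn_cder n w : nm w < 1 -> cder (Fn n) w (dFn n w).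
Proof.
move=> w1; apply: cderZ.
have D (k : 'I_n) : cder (fun z => z * G (pt n z k)) w
    (G (pt n w k) + (k%:R / n%:R : R)%:C * w * G' (pt n w k)).
  have -> : G (pt n w k) + (k%:R / n%:R : R)%:C * w * G' (pt n w k) =
    1 * G (pt n w k) + w * (G' (pt n w k) * ((k%:R / n%:R : R)%:C * 1)) by ring.
  apply: cderM; first exact: cder_id.
  apply: (@cder_comp _ (fun z => pt n z k) G); first exact: cderZ (cder_id w).
  by apply: Gd; apply: le_lt_trans w1; apply: nm_pt; exact: ltnW.
exact: (cder_sum (index_enum 'I_n) D).
Qed.

(** The integrand of [dFn], G(tw) + t w G'(tw), is the t-derivative of t G(tw), whose total
    increment over [0, 1] is G w. Comparing with the telescoping sum of T k = (k/n) G(pt k) leaves a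
    first-order error of G and an increment of G/n, each at most e/(2n) per term. *)
Let dFn_unif (r e : R) : r < 1 -> 0 < e -> exists N, forall n w, (N <= n)%N -> nm w <= r ->
  nm (dFn n w - G w) <= e.
Proof.
move=> r1 e0; have e2 : 0 < e / 2 by lra.
have [d1 d10 H1] := disk_strong_diff Gd G'c r1 e2.
have [d2 d20 H2] := disk_unif_cont Gc r1 e2.
set d := Num.min d1 d2; have d0 : 0 < d by rewrite lt_min d10.
exists (Num.truncn d^-1).+1 => n w Nn wr.
have nd : d^-1 < n%:R by apply: lt_le_trans (truncnS_gt _) _; rewrite ler_nat.
have n0 : (0 : R) < n%:R by apply: lt_trans nd; rewrite invr_gt0.
have n0C : n%:R != 0 :> C by rewrite pnatr_eq0 -lt0n -(ltr0n R).
have ptE k : pt n w k = k%:R / n%:R * w by rewrite /pt rmorphM fmorphV /= !rmorph_nat.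
have stepE k : pt n w k.+1 - pt n w k = w / n%:R.
  by rewrite !ptE -natr1; ring.
have w1 : nm w < 1 by apply: le_lt_trans wr r1.
have step k : nm (pt n w k.+1 - pt n w k) < d.
  rewrite stepE nmM nmV nm_nat ltr_pdivrMr// mulrC.
  by apply: lt_trans w1 _; rewrite -ltr_pdivrMr// mul1r.
pose T k := (k%:R / n%:R) * G (pt n w k).
have tel : G w = \sum_(k < n) (T k.+1 - T k).
  have := telescope_sumr T (leq0n n); rewrite big_mkord => ->.
  by rewrite /T mul0r mul0r subr0 ptE divff// !mul1r.
have -> : dFn n w - G w = \sum_(k < n) (- ((k%:R / n%:R) *
    (G (pt n w k.+1) - G (pt n w k) - G' (pt n w k) * (pt n w k.+1 - pt n w k)))
    - n%:R^-1 * (G (pt n w k.+1) - G (pt n w k))).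
  rewrite tel /dFn /mean mulr_sumr -sumrB; apply: eq_bigr => k _.
  rewrite stepE /T rmorphM fmorphV /= !rmorph_nat -natr1.
  by move: (G _) (G _) (G' _) => x y z; field.
apply: le_trans (nm_sum _ _) _.
have bound (k : 'I_n) : nm (- ((k%:R / n%:R) *
    (G (pt n w k.+1) - G (pt n w k) - G' (pt n w k) * (pt n w k.+1 - pt n w k)))
    - n%:R^-1 * (G (pt n w k.+1) - G (pt n w k))) <= n%:R^-1 * e.
  have p1 : nm (pt n w k) <= r by apply: le_trans wr; apply: nm_pt; exact: ltnW.
  have p2 : nm (pt n w k.+1) <= r by apply: le_trans wr; exact: nm_pt.
  have st := step k; rewrite lt_min in st; case/andP: st => st1 st2.
  apply: le_trans (nmB _ _) _; rewrite nmN.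
  have -> : n%:R^-1 * e = n%:R^-1 * (e / 2) + n%:R^-1 * (e / 2) :> R by field; rewrite gt_eqF.
  apply: lerD; last by rewrite nmM nmV nm_nat ler_wpM2l ?invr_ge0 ?(ltW n0)// H2.
  have kn : nm (k%:R / n%:R : C) <= 1.
    by rewrite nmM nmV !nm_nat ler_pdivrMr// mul1r ler_nat ltnW.
  rewrite nmM -[leRHS]mul1r; apply: ler_pM; rewrite ?nm_ge0//.
  apply: le_trans (H1 _ _ p1 p2 st1) _.
  rewrite stepE nmM nmV nm_nat mulrA mulrC ler_wpM2l ?invr_ge0 ?(ltW n0)//.
  by rewrite -[leRHS]mulr1 ler_wpM2l// ltW.
apply: le_trans (ler_sum _ (fun k _ => bound k)) _.
by rewrite sumr_const card_ord -[_ *+ n]mulr_natl mulrA divff ?mul1r// gt_eqF.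
Qed.

(** The derivatives [dFn] converge uniformly and all [Fn] vanish at 0, so the mean value estimate
    makes [Fn] Cauchy; the same estimate with c = G w passes to the limit and gives the
    derivative. *)
Lemma primitive_exists : exists2 F : C -> C, F 0 = 0 & forall z, nm z < 1 -> cder F z (G z).
Proof.
(* The condition |w| < 1 sits under the existential so that [choice] yields a total function,
   arbitrary off the disk. *)
have lim w : exists l, nm w < 1 -> clim (Fn^~ w) l.
  have [w1|] := boolP (nm w < 1); last by exists 0.
  suff [l Hl] : exists l, clim (Fn^~ w) l by exists l.
  apply: clim_cauchy => e e0; have e2 : 0 < e / 2 by lra.
  have [N HN] := dFn_unif w1 e2.
  exists N => n m nN mN.
  have n00 : nm (0 : C) <= nm w by rewrite nm0 nm_ge0.
  have S := on_seg_disk n00 (lexx (nm w)).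
  have D : on_seg (fun z => cder (fun z => Fn n z - Fn m z) z (dFn n z - dFn m z)) 0 w.
    by move=> t t01; apply: cderB; apply: Fn_cder; exact: le_lt_trans (S t t01) w1.
  have := @seg_diff_le _ _ _ 0 e 0 w D.
  rewrite mul0r subr0 subr0 [Fn n 0](_ : _ = 0); last first.
    by rewrite /Fn /mean big1 ?mulr0// => k _; rewrite mul0r.
  rewrite [Fn m 0](_ : _ = 0); last first.
    by rewrite /Fn /mean big1 ?mulr0// => k _; rewrite mul0r.
  rewrite !subr0 => H.
  apply: (@le_trans _ _ (e * nm w)).
    apply: H => t t01.
    have := S t t01; move: (0 + _) => z zw; rewrite subr0.
    have -> : dFn n z - dFn m z = (dFn n z - G z) - (dFn m z - G z) by ring.
    by apply: le_trans (nmB _ _) _; have := HN n z nN zw; have := HN m z mN zw; lra.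
  by rewrite -[leRHS]mulr1 ler_wpM2l ?ltW.
have [F HF] := choice lim.
exists F.
  have H0 : nm (0 : C) < 1 by rewrite nm0.
  apply: (clim_uniq (HF 0 H0)) => e e0; exists 0%N => n _.
  rewrite subr0 (_ : Fn n 0 = 0) ?nm0 ?ltW//.
  by rewrite /Fn /mean big1 ?mulr0// => k _; rewrite mul0r.
move=> w w1 e e0; have e2 : 0 < e / 2 by lra.
have [d d0 Hd] := Gc w1 e2.
set r := (1 + nm w) / 2.
have r1 : r < 1 by rewrite /r; lra.
have [N HN] := dFn_unif r1 e2.
exists (Num.min d (r - nm w)); first by rewrite lt_min d0 /r; lra.
move=> u; rewrite lt_min => /andP[ud ur].
have wr : nm w <= r by rewrite /r; lra.
have wur : nm (w + u) <= r by apply: le_trans (nmD _ _) _; lra.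
have S := on_seg_disk wr wur.
apply: (@clim_le _ (fun n => Fn n (w + u) + (-1) * Fn n w + (- (G w * u)))).
  apply: climD; last exact: clim_cst.
  have -> : F (w + u) - F w = F (w + u) + (-1) * F w by ring.
  apply: climD; first by apply: HF; exact: le_lt_trans r1.
  by apply: climZ; exact: HF.
exists N => n nN; rewrite mulN1r.
have := @seg_diff_le _ (Fn n) (dFn n) (G w) e w (w + u).
rewrite [w + u - w]addrC addKr; apply.
  by move=> t t01; apply: Fn_cder; exact: le_lt_trans (S t t01) r1.
move=> t t01.
have zr := S t t01; rewrite [w + u - w]addrC addKr in zr *.
set z := w + _ in zr *.
have -> : dFn n z - G w = (dFn n z - G z) + (G z - G w) by ring.
have tu : nm (t%:C * u) < d.
  apply: le_lt_trans ud; rewrite nmM nm_real; case/andP: t01 => t0 t1.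
  by rewrite ger0_norm// -[leRHS]mul1r ler_wpM2r ?nm_ge0.
apply: le_trans (nmD _ _) _; have := HN n z nN zr; have := Hd _ tu; rewrite -/z; lra.
Qed.

End Primitive.

(** * The function sqrt(1 + tanh) *)

Section TanhRoot.
Variable R : realType.
Local Notation C := R[i].

Lemma cexpE (x y : R) : cexp (Complex x y : CC R) = Complex (expR x * cos y) (expR x * sin y).
Proof.
rewrite /cexp; apply/eqP; rewrite eq_complex /=.
by apply/andP; split; apply/eqP; ring.
Qed.

Lemma cexpD (z w : C) : cexp (z + w : CC R) = (cexp (z : CC R) * cexp (w : CC R) : C).
Proof.
case: z w => [a b] [c d]; rewrite [Complex a b + _]/= !cexpE expRD sinD cosD.
by apply/eqP; rewrite eq_complex /=; apply/andP; split; apply/eqP; ring.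
Qed.

Lemma cexp0 : cexp (0 : CC R) = 1 :> C.
Proof. by rewrite (cexpE 0 0) expR0 cos0 sin0 mulr1 mulr0. Qed.

(** The real derivatives of exp, cos and sin are combined at 0 only; the addition formula carries
    the result to every point. *)
Lemma cder_cexp0 : cder (@cexp R) 0 1.
Proof.
(* The real part costs 3 k |u| and the imaginary part 2 k |u|, whence e/5. The radius k/4 below
   ensures |exp a - 1| <= k/2. *)
move=> e e0; set k := Num.min 1 (e / 5).
have k0 : 0 < k by rewrite lt_min ltr01; lra.
have k1 : k <= 1 by rewrite ge_min lexx.
have k5 : k * 5 <= e by rewrite -ler_pdivlMr// ge_min lexx orbT.
have [d1 d10 H1] := (real_is_deriveP _ _ _).1 (is_derive_expR (0 : R)) _ k0.
have [d2 d20 H2] := (real_is_deriveP _ _ _).1 (is_derive_cos (0 : R)) _ k0.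
have [d3 d30 H3] := (real_is_deriveP _ _ _).1 (is_derive_sin (0 : R)) _ k0.
exists (Num.min (Num.min d1 d2) (Num.min d3 (k / 4))).
  by rewrite !lt_min d10 d20 d30 divr_gt0.
move=> [a b]; rewrite !lt_min => /andP[/andP[u1 u2] /andP[u3 u4]].
have an := Re_le_nm (Complex a b); have bn := Im_le_nm (Complex a b).
rewrite add0r mul1r; set n := nm (Complex a b) in u1 u2 u3 u4 an bn *.
rewrite /= in an bn.
have := H1 a (le_lt_trans an u1); have := H2 b (le_lt_trans bn u2).
have := H3 b (le_lt_trans bn u3).
rewrite !add0r expR0 cos0 sin0 oppr0 mul0r ?oppr0 ?addr0 !mul1r.
rewrite cexpE cexp0.
set x := expR a; set c := cos b; set s := sin b => hs hc hx.
have n0 : 0 <= n by exact: nm_ge0.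
have [a0 b0] := (normr_ge0 a, normr_ge0 b).
have c1 : `|c| <= 1 by exact: cos_max.
have sl : `|s| <= 2 * n.
  have -> : s = (s - b) + b by ring.
  by apply: le_trans (ler_normD _ _) _; nra.
have xl : `|x - 1| <= k / 2.
  have -> : x - 1 = (x - 1 - a) + a by ring.
  by apply: le_trans (ler_normD _ _) _; nra.
apply: le_trans (nm_le_ReIm _) _ => /=.
have re : `|x * c - 1 - a| <= k * n + 2 * (k * n).
  have -> : x * c - 1 - a = c * (x - 1 - a) + (1 + a) * (c - 1) by ring.
  apply: le_trans (ler_normD _ _) _; rewrite !normrM; apply: lerD.
    have := normr_ge0 (x - 1 - a); nra.
  apply: ler_pM => //; last by apply: le_trans hc _; rewrite ler_wpM2l// ltW.
  by apply: le_trans (ler_normD _ _) _; rewrite normr1; lra.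
have im : `|x * s - 0 - b| <= k * n + k * n.
  have -> : x * s - 0 - b = (x - 1) * s + (s - b) by ring.
  apply: le_trans (ler_normD _ _) _; rewrite !normrM; apply: lerD.
    have := normr_ge0 (x - 1); have := normr_ge0 s; nra.
  by apply: le_trans hs _; rewrite ler_wpM2l// ltW.
nra.
Qed.

Lemma cder_cexp (z : C) : cder (@cexp R) z (cexp (z : CC R)).
Proof.
have D : cder (fun w => w - z) z 1.
  by have := cderB (cder_id z) (cder_cst z z); rewrite subr0.
have D0 : cder (@cexp R) (z - z) 1 by rewrite subrr; exact: cder_cexp0.
have := cderZ (cexp (z : CC R)) (cder_comp D D0); rewrite !mulr1.
by apply: cder_ext => w; rewrite -cexpD addrC subrK.
Qed.

Lemma psqrt_sqr (w : C) : psqrt (w : CC R) ^+ 2 = w :> C.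
Proof.
case: w => a b; rewrite /psqrt; set r := Num.sqrt (a ^+ 2 + b ^+ 2).
have r2 : r ^+ 2 = a ^+ 2 + b ^+ 2 by rewrite sqr_sqrtr// addr_ge0 ?sqr_ge0.
have r0 : 0 <= r by exact: sqrtr_ge0.
have ra : `|a| <= r by rewrite -sqrtr_sqr /r ler_wsqrtr// lerDl sqr_ge0.
have [p0 q0] : 0 <= (r + a) / 2 /\ 0 <= (r - a) / 2.
  by move: ra; rewrite ler_norml => /andP[? ?]; split; lra.
have p2 := sqr_sqrtr p0; have q2 := sqr_sqrtr q0.
have pq : Num.sqrt ((r + a) / 2) * Num.sqrt ((r - a) / 2) = `|b| / 2.
  rewrite -sqrtrM// (_ : _ * _ = (b / 2) ^+ 2); last first.
    by rewrite expr2 in r2; field: r2.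
  by rewrite sqrtr_sqr normrM (@ger0_norm _ 2^-1).
move: p2 q2 pq; set p := Num.sqrt ((r + a) / 2); set q := Num.sqrt ((r - a) / 2) => p2 q2 pq.
apply/eqP; rewrite eq_complex /=; apply/andP; split; apply/eqP.
  case: ifP => _; rewrite ?mulN1r ?mul1r; nra.
case: ifP => b0; move: pq.
  by rewrite ltr0_norm// => pq; nra.
by rewrite ger0_norm ?leNgt ?b0// => pq; nra.
Qed.

Lemma Re_psqrt_ge0 (w : C) : 0 <= complex.Re (psqrt (w : CC R)).
Proof.
case: w => a b; rewrite /psqrt /=.
by rewrite !(mul0r, mulr0, mul1r, subr0, addr0) sqrtr_ge0.
Qed.

(* |Im 2z| < 2 < pi on the disk *)
Lemma cexp_real_pos (z : C) (x : R) : nm z < 1 -> cexp (2 * z : CC R) = x%:C -> 0 < x.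
Proof.
case: z => a b z1.
have /andP[b1 b2] : -1 < b < 1.
  by have := le_lt_trans (Im_le_nm (Complex a b)) z1; rewrite ltr_norml.
move=> E; have : cexp (Complex (2 * a) (2 * b) : CC R) = x%:C.
  rewrite -E; congr cexp.
  by apply/eqP; rewrite eq_complex /=; apply/andP; split; apply/eqP; ring.
rewrite cexpE => -[<-] /eqP; rewrite mulf_eq0 gt_eqF ?expR_gt0//= => /eqP s0.
have pi2 := pi_ge2 R.
suff -> : b = 0 by rewrite mulr0 cos0 mulr1 expR_gt0.
have [b0|b0|//] := ltgtP b 0.
  have : 0 < sin (- (2 * b)) by apply: sin_gt0_pi; lra.
  by rewrite sinN s0 oppr0 ltxx.
have : 0 < sin (2 * b) by apply: sin_gt0_pi; lra.
by rewrite s0 ltxx.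
Qed.

Lemma cexpD1_neq0 (z : C) : nm z < 1 -> (cexp (2 * z : CC R) : C) + 1 != 0.
Proof.
move=> z1; apply/eqP => /eqP; rewrite addr_eq0 => /eqP E.
have := @cexp_real_pos z (-1) z1; rewrite E rmorphN1 => /(_ erefl); lra.
Qed.

Lemma tanh1E (z : C) : nm z < 1 ->
  (1 + ctanh (z : CC R) : C) = 2 * cexp (2 * z : CC R) / ((cexp (2 * z : CC R) : C) + 1).
Proof.
move=> /cexpD1_neq0; rewrite /ctanh; move: (cexp _ : C) => E E0.
by field.
Qed.

Lemma Bfun_sqr (z : C) : (Bfun (z : CC R) : C) ^+ 2 = 1 + ctanh (z : CC R).
Proof. exact: psqrt_sqr. Qed.

(** If Re B = 0 then B^2 = -s with s >= 0, and solving 2E/(E + 1) = -s gives E = -s/(2 + s), a real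
    value <= 0 that E = exp(2z) does not take on the disk. Positivity keeps B off the branch cut and
    later gives univalence. *)
Lemma Re_Bfun_gt0 (z : C) : nm z < 1 -> 0 < complex.Re (Bfun (z : CC R)).
Proof.
move=> z1; rewrite lt_neqAle Re_psqrt_ge0 andbT; apply/eqP => /esym B0.
have E0 := cexpD1_neq0 z1.
have := Bfun_sqr z; rewrite tanh1E//.
have -> : (Bfun (z : CC R) : C) ^+ 2 = - (complex.Im (Bfun (z : CC R)) ^+ 2)%:C.
  move: B0; case: (Bfun _) => a b /= ->.
  by apply/eqP; rewrite eq_complex /=; apply/andP; split; apply/eqP; ring.
set s := complex.Im _ ^+ 2; have s0 : 0 <= s by exact: sqr_ge0.
move=> H.
have s2 : 2 + s != 0 by rewrite gt_eqF//; lra.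
have s2C : (2 + s)%:C != 0 :> C by rewrite -nm_gt0 nm_real normr_gt0.
have : cexp (2 * z : CC R) = (- (s / (2 + s)))%:C.
  apply: (mulIf s2C); rewrite -[RHS]rmorphM /= mulNr divfK// rmorphN.
  have := congr1 (fun x : C => x * ((cexp (2 * z : CC R) : C) + 1)) H.
  rewrite divfK// rmorphD rmorph_nat /= => H'.
  transitivity (2 * (cexp (2 * z : CC R) : C) + s%:C * (cexp (2 * z : CC R) : C)); first by ring.
  by rewrite -H'; ring.
move=> /(cexp_real_pos z1); rewrite oppr_gt0 ltNge divr_ge0//; lra.
Qed.

Lemma Bfun_neq0 (z : C) : nm z < 1 -> Bfun (z : CC R) != 0 :> C.
Proof. by move=> /Re_Bfun_gt0; apply: contraTneq => ->; rewrite ltxx. Qed.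

(** No branch analysis is needed: |S(z + u) + S z| >= Re S z =: m because real parts are
    nonnegative. Dividing T(z + u) - T z by this sum bounds D = S(z + u) - S z linearly in u, so D^2
    is negligible in 2 S(z) D + D^2 = T(z + u) - T z. *)
Lemma cder_sqrt (S T : C -> C) (z t : C) :
  (forall w, S w ^+ 2 = T w) -> (forall w, 0 <= complex.Re (S w)) ->
  0 < complex.Re (S z) -> cder T z t -> cder S z (t / (2 * S z)).
Proof.
move=> ST S0 m0 HT e e0; set m := complex.Re (S z) in m0.
have mS : m <= nm (S z) by apply: le_trans (ler_norm _) (Re_le_nm _).
have Sz0 : S z != 0 by rewrite -nm_gt0; lra.
set k := Num.min 1 (e * nm (S z)).
have k0 : 0 < k by rewrite lt_min ltr01 mulr_gt0//; lra.
have k1 : k <= 1 by rewrite ge_min lexx.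
have ke : k <= e * nm (S z) by rewrite ge_min lexx orbT.
set K := ((nm t + 1) / m) ^+ 2.
have K0 : 0 <= K by exact: sqr_ge0.
have t0 := nm_ge0 t.
have [d d0 Hd] := HT _ k0.
exists (Num.min d (k / (1 + K))); first by rewrite lt_min d0 divr_gt0//; lra.
move=> u; rewrite lt_min => /andP[ud]; rewrite ltr_pdivlMr; last by lra.
move=> uk; have := Hd u ud; have u0 := nm_ge0 u.
rewrite -!ST; set D := S (z + u) - S z.
have -> : S (z + u) ^+ 2 - S z ^+ 2 - t * u = (2 * S z * D + D ^+ 2) - t * u.
  by rewrite /D; ring.
move=> H.
have D1 : nm D * m <= (nm t + 1) * nm u.
  have h1 : m <= nm (S (z + u) + S z).
    apply: le_trans (le_trans (ler_norm _) (Re_le_nm _)); rewrite ReD lerDr; exact: S0.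
  apply: (@le_trans _ _ (nm D * nm (S (z + u) + S z))).
    by rewrite ler_wpM2l// nm_ge0.
  rewrite -nmM.
  have -> : D * (S (z + u) + S z) = (2 * S z * D + D ^+ 2 - t * u) + t * u.
    by rewrite /D; ring.
  apply: le_trans (nmD _ _) _; rewrite (nmM t); nra.
have D2 : nm D ^+ 2 <= k * nm u.
  have : nm D <= (nm t + 1) / m * nm u by rewrite mulrAC ler_pdivlMr.
  move=> h; have : nm D ^+ 2 <= K * nm u ^+ 2.
    by rewrite /K -exprMn lerXn2r// nnegrE ?nm_ge0// mulr_ge0// divr_ge0; lra.
  nra.
have S2 : 2 * S z != 0 by rewrite mulf_neq0// pnatr_eq0.
have -> : D - t / (2 * S z) * u = ((2 * S z * D + D ^+ 2 - t * u) - D ^+ 2) / (2 * S z).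
  by field.
rewrite nmM nmV ler_pdivrMr ?nm_gt0// (nmM 2) nm_nat.
by apply: le_trans (nmB _ _) _; rewrite nmX; nra.
Qed.

(** T = 1 + tanh satisfies T' = 2T - T^2, so B' = T'/(2B) with T = B^2. The equation is autonomous,
    so derivatives of B o w can be computed with no further reference to tanh. *)
Lemma cder_Bfun (z : C) : nm z < 1 ->
  cder (@Bfun R) z (Bfun (z : CC R) - (Bfun (z : CC R) : C) ^+ 3 / 2).
Proof.
move=> z1; have E0 := cexpD1_neq0 z1; have B0 := Bfun_neq0 z1.
pose E (w : C) : C := cexp (2 * w : CC R).
have DE : cder E z (2 * E z).
  have := cder_comp (cderZ 2 (cder_id z)) (cder_cexp (2 * z)).
  by rewrite mulr1 mulrC.
have DT : cder (fun w => 1 + ctanh (w : CC R)) z (2 * (1 + ctanh (z : CC R)) - (1 + ctanh (z : CC R)) ^+ 2).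
  have DE1 a : cder (fun w => E w + a) z (2 * E z).
    by rewrite -[2 * E z]addr0; apply: cderD => //; exact: cder_cst.
  have := cderD (cder_cst 1 z) (@cder_div _ (fun w => E w - 1) (fun w => E w + 1) z _ _ E0 (DE1 (-1)) (DE1 1)).
  rewrite add0r tanh1E// -/(E z); rewrite -/(E z) in E0.
  by congr cder; move: (E z) E0 => y y0; field.
have := cder_sqrt Bfun_sqr (fun w => Re_psqrt_ge0 _) (Re_Bfun_gt0 z1) DT.
by congr cder; rewrite -Bfun_sqr; field.
Qed.

(** Since B^2 = 2E/(E + 1), the expression equals B/(E + 1). It is the divisor when w' is recovered
    from f''. *)
Lemma Bfun_derivative_neq0 (z : C) : nm z < 1 ->
  Bfun (z : CC R) - (Bfun (z : CC R) : C) ^+ 3 / 2 != 0 :> C.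
Proof.
move=> z1; have E0 := cexpD1_neq0 z1; have B0 := Bfun_neq0 z1.
rewrite exprS Bfun_sqr tanh1E//.
move: (cexp _ : C) E0 => y y0.
have -> : Bfun (z : CC R) - Bfun (z : CC R) * (2 * y / (y + 1)) / 2 = Bfun (z : CC R) / (y + 1) :> C.
  by move: (Bfun _ : C) => b; field.
by rewrite mulf_neq0// invr_neq0.
Qed.

Lemma Bfun0 : Bfun (0 : CC R) = 1 :> C.
Proof.
have z1 : nm (0 : C) < 1 by rewrite nm0.
have := Bfun_sqr 0; rewrite tanh1E// mulr0 cexp0 (_ : 2 * 1 / (1 + 1) = 1 :> C); last by field.
move=> /eqP; rewrite sqrf_eq1 => /orP[/eqP//|/eqP E].
by have := Re_Bfun_gt0 z1; rewrite E ReN oppr_gt0 ltr10.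
Qed.

End TanhRoot.

(** * Logarithmic coefficients, the two bounds, and members of the class *)

Section BoundedTurning.
Variable R : realType.
Local Notation C := R[i].

Lemma inD_nm (z : C) : inD (z : CC R) <-> nm z < 1.
Proof. by rewrite /inD normr_nm -(rmorph1 (real_complex R)) ltcR. Qed.

Lemma cder_eq_disk (f g : C -> C) z l : (forall z, nm z < 1 -> f z = g z) -> nm z < 1 ->
  cder f z l -> cder g z l.
Proof.
move=> fg z1; apply: cder_eq; exists (1 - nm z); first by lra.
by move=> u ud; apply: fg; apply: le_lt_trans (nmD _ _) _; lra.
Qed.

Section Coefficients.
Variables (f w w' : C -> C).
Hypothesis fE : forall z, nm z < 1 -> derive1 (f : CC R -> CC R) z = Bfun (w z : CC R).
Hypothesis wd : forall z, nm z < 1 -> cder w z (w' z).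
Hypothesis w1 : forall z, nm z < 1 -> nm (w z) < 1.

Let G z : C := Bfun (w z : CC R).

Lemma cder_G z : nm z < 1 -> cder G z ((G z - G z ^+ 3 / 2) * w' z).
Proof. by move=> z1; apply: cder_comp (wd z1) _; apply: cder_Bfun; exact: w1. Qed.

Lemma cder_derive1_f z : nm z < 1 ->
  cder (derive1 (f : CC R -> CC R)) z ((G z - G z ^+ 3 / 2) * w' z).
Proof.
by move=> z1; apply: (cder_eq_disk _ z1 (cder_G z1)) => x x1; rewrite fE.
Qed.

Hypothesis w0 : w 0 = 0.

Lemma BT_coefs l : cder w' 0 l ->
  coef (f : CC R -> CC R) 2 = w' 0 / 4 :> C /\
  coef (f : CC R -> CC R) 3 = l / 12 - w' 0 ^+ 2 / 24 :> C.
Proof.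
move=> w'd; have z1 : nm (0 : C) < 1 by rewrite nm0.
have G0 : G 0 = 1 by rewrite /G w0 Bfun0.
have f2E z : nm z < 1 -> derive1n 2 (f : CC R -> CC R) z = (G z - G z ^+ 3 / 2) * w' z :> C.
  by move=> {}z1; exact: cder_derive1 (cder_derive1_f z1).
have f3E : derive1n 3 (f : CC R -> CC R) 0 = l / 2 - w' 0 ^+ 2 / 4 :> C.
  apply: cder_derive1.
  have D : cder (fun z => (G z - G z ^+ 3 / 2) * w' z) 0 (l / 2 - w' 0 ^+ 2 / 4).
    have G3 := cderM (cderX 3 (cder_G z1)) (cder_cst (2^-1) 0).
    have := cderM (cderB (cder_G z1) G3) w'd.
    by congr cder; rewrite /= G0; field.
  by apply: (cder_eq_disk _ z1 D) => z {}z1; symmetry; exact: f2E.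
split.
  rewrite /coef (f2E 0 z1) G0; transitivity ((1 - 1 ^+ 3 / 2) * w' 0 / 2); first by [].
  by field.
rewrite /coef f3E; transitivity ((l / 2 - w' 0 ^+ 2 / 4) / 6); first by [].
by field.
Qed.

(** Here l = w''(0), so l / 2 is the second Taylor coefficient of w. The constant 7/16 collects 1/4
    from the second-order term of B and 3/16 from a_2^2/2. *)
Lemma BT_gammas l : cder w' 0 l ->
  `|gamma2 (f : CC R -> CC R)| - `|gamma1 (f : CC R -> CC R)| =
  (nm (l / 2 - 7 / 16 * w' 0 ^+ 2) / 12 - nm (w' 0) / 8)%:C.
Proof.
move=> /BT_coefs[c2 c3].
have g1 : gamma1 (f : CC R -> CC R) = w' 0 / 8 :> C.
  by rewrite /gamma1 c2; field.
have g2 : gamma2 (f : CC R -> CC R) = (l / 2 - 7 / 16 * w' 0 ^+ 2) / 12 :> C.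
  by rewrite /gamma2 c2 c3; field.
rewrite g1 g2 !normr_nm -rmorphB /=; congr (_%:C).
by rewrite nmM (nmM (w' 0)) !nmV !nm_nat.
Qed.

End Coefficients.

(** With a = |c1|, the first modulus is at least max(0, (7/16 + 1) a^2 - 1), whence 23. The
    resulting lower bound decreases up to the kink a = 4/sqrt 23 and increases after it, so the
    minimum is -a/8 at the kink. The upper estimate is largest at a = 0. *)
Lemma gamma_difference_bounds (c1 c2 : C) : nm c2 + nm c1 ^+ 2 <= 1 ->
  - (2 * Num.sqrt (23 : R))^-1 <= nm (c2 - 7 / 16 * c1 ^+ 2) / 12 - nm c1 / 8 <= 12^-1.
Proof.
set a := nm c1; set b := nm c2 => ab.
have a0 : 0 <= a by exact: nm_ge0.
have b0 : 0 <= b by exact: nm_ge0.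
set s := Num.sqrt 23.
have s2 : s ^+ 2 = 23 by rewrite sqr_sqrtr.
have s0 : 0 < s by rewrite sqrtr_gt0.
have nE : nm (7 / 16 * c1 ^+ 2) = 7 / 16 * a ^+ 2.
  by rewrite nmM nmX nmM nmV !nm_nat.
have up := nmB c2 (7 / 16 * c1 ^+ 2).
have lo := nmBB (7 / 16 * c1 ^+ 2) c2.
rewrite nmBC nE -/b in lo; rewrite nE -/b in up.
have n0 := nm_ge0 (c2 - 7 / 16 * c1 ^+ 2).
move: (nm (c2 - _)) lo up n0 => g lo up g0.
apply/andP; split; last by nra.
set t := s^-1; have t0 : 0 < t by rewrite invr_gt0.
have ts : t * s = 1 by rewrite mulVf// gt_eqF.
have -> : (2 * s)^-1 = t / 2 by rewrite invfM mulrC.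
(* The crude t <= 1/3 suffices: for y = a s > 4, cancelling y - 4 reduces the claim to t <= (y +
   4)/24, and y + 4 > 8. *)
have s3 : 3 <= s by nra.
have t3 : t <= 3^-1 by rewrite lef_pV2 ?posrE.
have [le4|gt4] := leP (a * s) 4.
  have : a <= 4 * t by rewrite -(ler_pM2r s0) -mulrA ts mulr1.
  lra.
have e1 : a ^+ 2 = (a * s) ^+ 2 / 23 by rewrite exprMn s2; field.
have e2 : a = a * s * t by rewrite -mulrA [s * t]mulrC ts mulr1.
suff : - (t / 2) <= ((a * s) ^+ 2 / 16 - 1) / 12 - a * s * t / 8 by rewrite -e2; lra.
move: (a * s) gt4 => y y4; nra.
Qed.

Lemma BT_bounds (f : CC R -> CC R) : classBT f ->
  - (2 * (Num.sqrt (23 : R))%:C)^-1 <= `|gamma2 f| - `|gamma1 f| <= 12^-1.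
Proof.
move=> [[fd _ _ _] [w [wd w1 w0 fE]]].
have {}fE z : nm z < 1 -> derive1 f z = Bfun (w z) by move=> /inD_nm /fE.
have {}w1 (z : C) : nm z < 1 -> nm (w z) < 1 by move=> /inD_nm /w1 /inD_nm.
pose f1 := derive1 f; pose w' := derive1 w.
have {}wd z : nm z < 1 -> cder w z (w' z) by move=> /inD_nm /wd /derivable_cder.
have {}fd z : nm z < 1 -> cder f z (f1 z) by move=> /inD_nm /fd /derivable_cder.
have f1d := cder_derive1_f fE wd w1.
have f1c z : nm z < 1 -> ccont f1 z by move=> z1; apply: ccont_cder (f1d z z1).
have w'd z : nm z < 1 -> exists l, cder w' z l.
  move=> z1; have [_ [l D]] := C1_holo_C3 fd f1c z1.
  pose P (z : C) : C := (Bfun (w z) : C) - (Bfun (w z) : C) ^+ 3 / 2.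
  have P0 x : nm x < 1 -> P x != 0 by move=> x1; apply: Bfun_derivative_neq0; exact: w1.
  have G3 := cderM (cderX 3 (cder_G wd w1 z1)) (cder_cst (2^-1) z).
  have D' := cder_div (P0 z z1) D (cderB (cder_G wd w1 z1) G3).
  eexists; apply: (cder_eq_disk _ z1 D') => x x1.
  rewrite (cder_derive1 (f1d x x1)) -/(P x) mulrC mulKf//; exact: P0.
have w'c z : nm z < 1 -> ccont w' z by move=> /w'd[l]; exact: ccont_cder.
have z1 : nm (0 : C) < 1 by rewrite nm0.
have [l D] := w'd 0 z1.
rewrite (BT_gammas fE wd w1 w0 D).
have B := second_coef_bound wd w'c (fun z z1 => ltW (w1 z z1)) w0.
rewrite (cder_derive1 D) in B.
have /andP[lo up] := gamma_difference_bounds B.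
have e1 : (2 * (Num.sqrt (23 : R))%:C)^-1 = ((2 * Num.sqrt (23 : R))^-1)%:C :> CC R.
  by rewrite fmorphV rmorphM rmorph_nat.
have e2 : 12^-1 = (12^-1 : R)%:C :> CC R by rewrite fmorphV rmorph_nat.
by rewrite e1 e2 -rmorphN !lecR lo.
Qed.

(** Turns a Schwarz function into a member of the class. The second derivative of w makes the
    derivative of B o w continuous, as the construction of the primitive requires, and supplies
    c2. *)
Lemma BT_primitive (w w' w'' : C -> C) :
  (forall z, nm z < 1 -> cder w z (w' z)) -> (forall z, nm z < 1 -> cder w' z (w'' z)) ->
  (forall z, nm z < 1 -> nm (w z) < 1) -> w 0 = 0 ->
  exists f : CC R -> CC R,
    [/\ f 0 = 0, holoD f, forall z, inD z -> derive1 f z = Bfun (w z : CC R), classBT f &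
     `|gamma2 f| - `|gamma1 f| =
       (nm (w'' 0 / 2 - 7 / 16 * w' 0 ^+ 2) / 12 - nm (w' 0) / 8)%:C].
Proof.
move=> wd w'd w1 w0.
pose G z : C := Bfun (w z : CC R).
have Gd : forall z, nm z < 1 -> cder G z ((G z - G z ^+ 3 / 2) * w' z) := cder_G wd w1.
have G'c z : nm z < 1 -> ccont (fun z => (G z - G z ^+ 3 / 2) * w' z) z.
  move=> z1; have G3 := cderM (cderX 3 (Gd z z1)) (cder_cst (2^-1) z).
  exact: ccont_cder (cderM (cderB (Gd z z1) G3) (w'd z z1)).
have [f f0 fd] := primitive_exists Gd G'c.
have fE z : nm z < 1 -> derive1 (f : CC R -> CC R) z = Bfun (w z : CC R).
  by move=> z1; exact: cder_derive1 (fd z z1).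
have z1 : nm (0 : C) < 1 by rewrite nm0.
have fH : holoD (f : CC R -> CC R) by move=> z /inD_nm z2; exact: cder_derivable (fd z z2).
exists f; split => //.
- by move=> z /inD_nm; exact: fE.
- split.
    split => //; last by rewrite fE// w0 Bfun0.
    (* Noshiro-Warschawski: Re f' > 0 on a convex domain *)
    move=> z v /inD_nm zD /inD_nm vD fzv; apply/eqP; rewrite eq_sym -subr_eq0.
    apply: contraT => zv.
    pose r := Num.max (nm z) (nm v).
    have r1 : r < 1 by rewrite gt_max zD.
    have zr : nm z <= r by rewrite le_max lexx.
    have vr : nm v <= r by rewrite le_max lexx orbT.
    have S := on_seg_disk zr vr.
    have D : on_seg (fun x => cder f x (G x)) z v.
      by move=> t t01; apply: fd; exact: le_lt_trans (S t t01) r1.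
    (* With e the conjugate of v - z, the right-hand side is |v - z|^2 Re f' at a point of the
       segment, and f z = f v makes the left-hand side 0. *)
    have [t t01] := seg_MVT ((v - z)^*%C) D.
    rewrite fzv subrr mulr0 mulrCA [_^*%C * _]mulrC -sqr_normc normr_nm -rmorphXn mulrC ReZ => /esym/eqP.
    have := Re_Bfun_gt0 (w1 _ (le_lt_trans (S t t01) r1)).
    rewrite mulf_eq0 sqrf_eq0 nm_eq0 (negPf zv) /= => + /eqP E.
    by rewrite -[complex.Re _]/(complex.Re (G _)) E ltxx.
  exists w; split; [|by move=> z /inD_nm/w1/inD_nm|exact: w0|by move=> z /inD_nm; exact: fE].
  by move=> z /inD_nm z2; exact: cder_derivable (wd z z2).
- exact: BT_gammas fE wd w1 w0 _ (w'd 0 z1).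
Qed.

End BoundedTurning.

(** * Extremal functions *)

Section Extremals.
Variable R : realType.
Local Notation C := R[i].

Lemma upper_extremal : exists f2 : CC R -> CC R,
  [/\ f2 0 = 0, holoD f2, (forall z, inD z -> derive1 f2 z = Bfun (z ^+ 2)),
      classBT f2 & `|gamma2 f2| - `|gamma1 f2| = 12^-1].
Proof.
have := @BT_primitive R (fun z => z ^+ 2) (fun z => 2 * z) (fun=> 2).
case.
- move=> z _; have := cderX 2 (cder_id z).
  by congr cder; rewrite /= expr1 mulr1.
- by move=> z _; have := cderZ 2 (cder_id z); rewrite mulr1.
- by move=> z z1; rewrite nmX expr_lt1 ?nm_ge0.
- by rewrite expr0n.
move=> f [f0 fd fE fB fg]; exists f; split => //; rewrite fg.
rewrite mulr0 expr0n mulr0 subr0 divff ?pnatr_eq0// nm1 nm0 mul0r subr0 mul1r.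
by rewrite fmorphV rmorph_nat.
Qed.

Lemma lower_extremal : exists f : CC R -> CC R,
  [/\ f 0 = 0, holoD f, (forall z, inD z -> derive1 f z = Bfun (omega_ext z)),
      classBT f & `|gamma2 f| - `|gamma1 f| = - (2 * (Num.sqrt (23 : R))%:C)^-1].
Proof.
set s := Num.sqrt (23 : R).
have s2 : s ^+ 2 = 23 by rewrite sqr_sqrtr.
have s0 : 0 < s by rewrite sqrtr_gt0.
(* For this w, c1 = a and c2 = 1 - a^2; the value of a solves 1 - a^2 = 7/16 a^2, so gamma2 = 0 and
   the difference is -a/8. *)
pose x : R := 4 / s.
have x0 : 0 < x by rewrite divr_gt0.
have x2 : x ^+ 2 = 16 / 23 by rewrite expr_div_n s2; field.
have x1 : x < 1 by nra.
pose a : C := x%:C.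
have na : nm a = x by rewrite nm_real gtr0_norm.
have den (z : C) : nm z < 1 -> 1 + a * z != 0.
  move=> z1; rewrite -nm_gt0; have := nmBB 1 (- (a * z)).
  by rewrite opprK nm1 nmN nmM na; have := nm_ge0 z; nra.
pose w (z : C) := z * (z + a) / (1 + a * z).
pose w' (z : C) := (a + 2 * z + a * z ^+ 2) / (1 + a * z) ^+ 2.
pose w'' (z : C) := ((2 + 2 * a * z) * (1 + a * z) ^+ 2
   - (a + 2 * z + a * z ^+ 2) * (2 * (1 + a * z) * a)) / (1 + a * z) ^+ 4.
have dden (z : C) : cder (fun z => 1 + a * z) z a.
  by have := cderD (cder_cst 1 z) (cderZ a (cder_id z)); rewrite add0r mulr1.
have wd (z : C) : nm z < 1 -> cder w z (w' z).
  move=> z1; have Da := cderD (cder_id z) (cder_cst a z).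
  have := @cder_div _ (fun z => z * (z + a)) (fun z => 1 + a * z) z _ _ (den z z1)
    (cderM (cder_id z) Da) (dden z).
  by congr cder; rewrite /w'; have := den z z1 => D; field.
have w'd (z : C) : nm z < 1 -> cder w' z (w'' z).
  move=> z1; have Dz := den z z1.
  have N := cderD (cderD (cder_cst a z) (cderZ 2 (cder_id z))) (cderZ a (cderX 2 (cder_id z))).
  have Dz2 : (1 + a * z) ^+ 2 != 0 by rewrite expf_neq0.
  have := @cder_div _ (fun z => a + 2 * z + a * z ^+ 2) (fun z => (1 + a * z) ^+ 2) z _ _
    Dz2 N (cderX 2 (dden z)).
  by congr cder; rewrite /w'' /= expr1; field.
have w1 (z : C) : nm z < 1 -> nm (w z) < 1.
  move=> z1; rewrite /w -mulrA nmM.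
  apply: (le_lt_trans _ z1); rewrite -[leRHS]mulr1 ler_wpM2l ?nm_ge0//.
  rewrite nmM nmV ler_pdivrMr ?nm_gt0 ?den// mul1r.
  (* The Blaschke factor is bounded by 1 because |1 + a z|^2 - |z + a|^2 = (1 - a^2)(1 - |z|^2). *)
  rewrite -(@ler_pXn2r _ 2)// ?nnegrE ?nm_ge0//.
  have nz2 : nm z ^+ 2 <= 1 by rewrite expr_le1 ?nm_ge0 ?ltW.
  move: nz2; rewrite !nm_sq; case: z {z1} => p q /=; rewrite !(mul0r, addr0, add0r, subr0); nra.
have w0 : w 0 = 0 by rewrite /w !mul0r.
have [f [f0 fd fE fB fg]] := BT_primitive wd w'd w1 w0.
exists f; split => //.
  move=> z zD; rewrite fE//; congr Bfun; have z1 := (inD_nm z).1 zD.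
  have q0 : 1 - (z : C) ^+ 2 != 0.
    rewrite -nm_gt0; have := nmBB 1 ((z : C) ^+ 2).
    by rewrite nm1 nmX; have := nm_ge0 z; nra.
  have -> : omega_ext z = (((1 + 2 * a * z + z ^+ 2) / (1 - z ^+ 2) - 1) /
       ((1 + 2 * a * z + z ^+ 2) / (1 - z ^+ 2) + 1) : C).
    rewrite /omega_ext /pext; have -> : (8 / Num.sqrt (23 : R))%:C = 2 * a :> C.
      rewrite /a -[2](rmorph_nat (real_complex R) 2) -rmorphM; congr (_%:C).
      by rewrite /x -/s; field; rewrite gt_eqF.
    by [].
  (* The identities p + 1 = 2(1 + yv)/(1 - v^2) and p - 1 = 2v(v + y)/(1 - v^2) are behind this; the
     first is isolated so that [field] sees a nonzero denominator. *)
  have alg (y v : C) : 1 + y * v != 0 -> 1 - v ^+ 2 != 0 ->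
      ((1 + 2 * y * v + v ^+ 2) / (1 - v ^+ 2) - 1) / ((1 + 2 * y * v + v ^+ 2) / (1 - v ^+ 2) + 1)
      = v * (v + y) / (1 + y * v).
    move=> yv v2; have -> : (1 + 2 * y * v + v ^+ 2) / (1 - v ^+ 2) + 1 = 2 * (1 + y * v) / (1 - v ^+ 2).
      by field.
    by field; rewrite yv.
  by symmetry; exact: (alg a z (den z z1) q0).
rewrite fg.
have -> : w' 0 = a by rewrite /w'; field.
have -> : w'' 0 / 2 - 7 / 16 * a ^+ 2 = 0.
  have a2 : a ^+ 2 = 16 / 23.
    by rewrite /a -rmorphXn /= x2 rmorphM fmorphV !rmorph_nat.
  have -> : w'' 0 / 2 = 1 - a ^+ 2 by rewrite /w''; field.
  by rewrite a2; field.
rewrite nm0 mul0r sub0r na /x -[2](rmorph_nat (real_complex R) 2).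
rewrite -rmorphM -fmorphV -rmorphN; congr (_%:C) => /=.
by field; rewrite gt_eqF.
Qed.

End Extremals.

Theorem theorem7p1 (R : realType) :
  (forall f : CC R -> CC R, classBT f ->
     - (2 * (Num.sqrt (23 : R))%:C)^-1 <= `|gamma2 f| - `|gamma1 f|
     <= 12^-1)
  /\ (exists f2 : CC R -> CC R,
        [/\ f2 0 = 0, holoD f2,
            (forall z, inD z -> derive1 f2 z = Bfun (z ^+ 2)),
            classBT f2 &
            `|gamma2 f2| - `|gamma1 f2| = 12^-1])
  /\ (exists f : CC R -> CC R,
        [/\ f 0 = 0, holoD f,
            (forall z, inD z -> derive1 f z = Bfun (omega_ext z)),
            classBT f &
            `|gamma2 f| - `|gamma1 f| = - (2 * (Num.sqrt (23 : R))%:C)^-1]).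
Proof.
split; first exact: BT_bounds.
by split; [exact: upper_extremal|exact: lower_extremal].
Qed.
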